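(* The vanishing of the second bounded cohomology with coefficients in the regular representation is a measure equivalence invariant: if $\Gamma$ and $\Lambda$ are measure equivalent countable groups, then $\mathrm H^2_{\mathrm b}(\Gamma,\ell^2(\Gamma))=0$ if and only if $\mathrm H^2_{\mathrm b}(\Lambda,\ell^2(\Lambda))=0$.
   Context: Bounded cohomology: for a countable discrete group $\Gamma$ and a unitary representation $\pi$ of $\Gamma$ on a separable Hilbert space $\mathcal H$, $\mathrm H^n_{\mathrm b}(\Gamma,\pi)$ is the $n$-th cohomology of the complex $0\to\ell^\infty(\Gamma,\mathcal H)^\Gamma\to\ell^\infty(\Gamma^2,\mathcal H)^\Gamma\to\cdots$ of bounded functions invariant under $(\gamma f)(\gamma_0,\dots,\gamma_n)=\pi(\gamma)f(\gamma^{-1}\gamma_0,\dots,\gamma^{-1}\gamma_n)$, with the usual homogeneous coboundary maps ($\ell^\infty(\Gamma^{n+1},\mathcal H)^\Gamma$ in degree $n$). Here $\ell^2(\Gamma)$ carries the regular representation. Two countable groups $\Gamma,\Lambda$ are measure equivalent if there is a standard (possibly infinite) measure space $(\Sigma,m)$ with commuting measure-preserving $\Gamma$- and $\Lambda$-actions such that each one of the two actions admits a finite measure fundamental domain. *)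

(* Defs.v *)
From HB Require Import structures.
From mathcomp Require Import all_boot all_order all_algebra.
From mathcomp Require Import complex.
From mathcomp Require Import all_classical all_reals all_analysis.
From mathcomp Require Import ring lra.

Set Implicit Arguments.
Unset Strict Implicit.
Unset Printing Implicit Defensive.

Import Order.TTheory GRing.Theory Num.Theory.
Import numFieldNormedType.Exports.
Import ComplexField.Normc.

Local Open Scope classical_set_scope.
Local Open Scope ring_scope.

Section SquareSummable.
Variables (R : realType) (X : choiceType).
Local Notation C := R[i].
Implicit Types (f g : X -> C^o).

Definition l2_sqnorm f : \bar R :=
  (\esum_(x in [set: X]) ((normc (f x)) ^+ 2)%:E)%E.

Definition square_summable : {pred X -> C^o} := fun f => (l2_sqnorm f < +oo)%E.

Lemma l2_sqnorm_ge0 f : (0 <= l2_sqnorm f)%E.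
Proof. by apply: esum_ge0 => x _; rewrite lee_fin sqr_ge0. Qed.

Lemma l2_sqnormK f : f \in square_summable ->
  (fine (l2_sqnorm f))%:E = l2_sqnorm f.
Proof.
by move=> ff; rewrite fineK// fin_numE gt_eqF ?(lt_le_trans _ (l2_sqnorm_ge0 f))//= lt_eqF.
Qed.

Lemma esumZ_le (c : R) (a : X -> \bar R) : 0 <= c -> (forall x, 0 <= a x)%E ->
  (\esum_(x in [set: X]) (c%:E * a x) <= c%:E * \esum_(x in [set: X]) a x)%E.
Proof.
move=> c0 a0; apply: ge_ereal_sup => _ [A AX <-].
rewrite -ge0_mule_fsumr//; apply: lee_wpmul2l; first by rewrite lee_fin.
by apply: ereal_sup_ubound; exists A.
Qed.

Lemma l2_sqnormZ_le (c : C) f :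
  (l2_sqnorm (c *: f) <= (normc c ^+ 2)%:E * l2_sqnorm f)%E.
Proof.
apply: le_trans (esumZ_le _ _); last 2 first.
- exact: sqr_ge0.
- by move=> x; rewrite lee_fin sqr_ge0.
by apply: le_esum => x _; rewrite [(c *: f) x]/(c * f x) normcM exprMn.
Qed.

Lemma l2_sqnormD_le (a b : R) f g : 0 < a -> 0 < b ->
  (l2_sqnorm f <= (a ^+ 2)%:E)%E -> (l2_sqnorm g <= (b ^+ 2)%:E)%E ->
  (l2_sqnorm (f + g)%R <= ((a + b) ^+ 2)%:E)%E.
Proof.
move=> a0 b0 fa gb.
have ca : 0 <= (a + b) / a by rewrite divr_ge0// ?addr_ge0// ltW.
have cb : 0 <= (a + b) / b by rewrite divr_ge0// ?addr_ge0// ltW.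
have -> : ((a + b) ^+ 2)%:E =
    (((a + b) / a)%:E * (a ^+ 2)%:E + ((a + b) / b)%:E * (b ^+ 2)%:E)%E.
  by rewrite -!EFinM -EFinD; congr EFin; field; rewrite !gt_eqF.
apply: le_trans (leeD (lee_wpmul2l _ fa) (lee_wpmul2l _ gb)); rewrite ?lee_fin//.
apply: le_trans (leeD (esumZ_le _ _) (esumZ_le _ _)) => //; last 2 first.
- by move=> x; rewrite lee_fin sqr_ge0.
- by move=> x; rewrite lee_fin sqr_ge0.
rewrite -esumD; last 2 first.
- by move=> x _; rewrite -EFinM lee_fin mulr_ge0 ?sqr_ge0.
- by move=> x _; rewrite -EFinM lee_fin mulr_ge0 ?sqr_ge0.
apply: le_esum => x _; rewrite -!EFinM -EFinD lee_fin.
set u := normc (f x); set v := normc (g x).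
apply: (@le_trans _ _ ((u + v) ^+ 2)).
  have n0 (z : C) : 0 <= normc z by case: z => ? ?; rewrite sqrtr_ge0.
  by rewrite ler_sqr ?nnegrE ?addr_ge0 ?n0//; exact: (@le_normcD R (f x) (g x)).
rewrite -subr_ge0.
have -> : (a + b) / a * u ^+ 2 + (a + b) / b * v ^+ 2 - (u + v) ^+ 2 =
    (u * b - v * a) ^+ 2 / (a * b) by field; rewrite !gt_eqF.
by rewrite divr_ge0 ?sqr_ge0// mulr_ge0// ltW.
Qed.

Lemma l2_sqnorm0 : l2_sqnorm 0 = 0%E.
Proof. by apply: esum1 => x _; rewrite normc0 expr0n. Qed.

Lemma l2_sqnorm_le f (e : R) : f \in square_summable -> 0 < e ->
  (l2_sqnorm f <= ((Num.sqrt (fine (l2_sqnorm f)) + e) ^+ 2)%:E)%E.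
Proof.
move=> ff e0; have n0 : 0 <= fine (l2_sqnorm f) by rewrite fine_ge0 ?l2_sqnorm_ge0.
rewrite -{1}l2_sqnormK// lee_fin -{1}(sqr_sqrtr n0) ler_sqr ?nnegrE ?sqrtr_ge0//.
  by rewrite lerDl ltW.
by rewrite addr_ge0 ?sqrtr_ge0// ltW.
Qed.

Lemma square_summable_submod : submod_closed square_summable.
Proof.
split; first by rewrite unfold_in l2_sqnorm0 ltry.
move=> c f g fs gs.
have cfs : c *: f \in square_summable.
  rewrite unfold_in; apply: le_lt_trans (l2_sqnormZ_le _ _) _.
  by rewrite -l2_sqnormK// -EFinM ltry.
rewrite unfold_in.
have p (h : X -> C^o) : 0 < Num.sqrt (fine (l2_sqnorm h)) + 1.
  by rewrite ltr_wpDl// sqrtr_ge0.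
apply: le_lt_trans (ltry _).
exact: (l2_sqnormD_le (p _) (p _) (l2_sqnorm_le cfs ltr01)
  (l2_sqnorm_le gs ltr01)).
Qed.

HB.instance Definition _ :=
  GRing.isSubmodClosed.Build C (X -> C^o) square_summable square_summable_submod.

Record l2 := L2 { l2_fun :> X -> C^o; l2_funP : l2_fun \in square_summable }.

HB.instance Definition _ := [isSub for l2_fun].
HB.instance Definition _ := [Choice of l2 by <:].
HB.instance Definition _ := [SubChoice_isSubLmodule of l2 by <:].

(* A normedModType over C has a C-valued norm, hence the embedding l2_normC. *)
Definition l2_norm (f : l2) : R := Num.sqrt (fine (l2_sqnorm f)).

Let l2_normC (f : l2) : C := (l2_norm f)%:C%C.

Lemma l2_normD (f g : l2) : l2_normC (f + g) <= l2_normC f + l2_normC g.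
Proof.
rewrite /l2_normC -rmorphD lecR; apply/ler_addgt0Pr => e e0.
have e2 : 0 < e / 2 by rewrite divr_gt0.
have p (h : l2) : 0 < l2_norm h + e / 2 by rewrite ltr_wpDl// sqrtr_ge0.
have := l2_sqnormD_le (p f) (p g) (l2_sqnorm_le (l2_funP f) e2)
  (l2_sqnorm_le (l2_funP g) e2).
rewrite -[l2_fun f + l2_fun g]/(l2_fun (f + g)).
rewrite -l2_sqnormK ?l2_funP// lee_fin => H.
have -> : l2_norm f + l2_norm g + e = l2_norm f + e / 2 + (l2_norm g + e / 2) by lra.
have s0 := addr_gt0 (p f) (p g).
by rewrite -(ger0_norm (ltW s0)) -sqrtr_sqr ler_wsqrtr.
Qed.

Lemma l2_normZ_le (c : C) (f : l2) : l2_norm (c *: f) <= normc c * l2_norm f.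
Proof.
have c0 : 0 <= normc c by case: (c) => ? ?; rewrite sqrtr_ge0.
rewrite -{1}(ger0_norm c0) -sqrtr_sqr -sqrtrM ?sqr_ge0// ler_wsqrtr//.
rewrite -lee_fin EFinM !l2_sqnormK ?l2_funP//; exact: l2_sqnormZ_le.
Qed.

Lemma l2_normZ (c : C) (f : l2) : l2_normC (c *: f) = `|c| * l2_normC f.
Proof.
have -> : `|c| = (normc c)%:C%C by case: c.
rewrite /l2_normC -rmorphM; congr (_%:C)%C.
have [->|c0] := eqVneq c 0.
  rewrite normc0 mul0r scale0r /l2_norm.
  by rewrite -[l2_fun 0]/(0 : X -> C^o) l2_sqnorm0 sqrtr0.
apply/eqP; rewrite eq_le l2_normZ_le/=.
have nc0 : normc c != 0 by apply: contra_neq c0 => /eq0_normc.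
have := l2_normZ_le c^-1 (c *: f); rewrite scalerA mulVf// scale1r normcV.
move=> H; rewrite mulrC -ler_pdivlMr ?[_ / _]mulrC//.
by rewrite lt_neqAle eq_sym nc0/=; case: (c) => ? ?; rewrite sqrtr_ge0.
Qed.

Lemma l2_norm0_eq0 (f : l2) : l2_normC f = 0 -> f = 0.
Proof.
move=> /(congr1 (@complex.Re R)) /= /eqP; rewrite sqrtr_eq0 => f0.
apply: val_inj; apply/funext => x /=; apply: eq0_normc.
have : ((normc (f x) ^+ 2)%:E <= l2_sqnorm f)%E.
  apply: esum_ge; exists [set x]; last by rewrite fsbig_set1.
  by split => //; exact: finite_set1.
rewrite -l2_sqnormK ?l2_funP// lee_fin => /le_trans/(_ f0) H.
by apply/eqP; rewrite -sqrf_eq0 eq_le H sqr_ge0.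
Qed.

HB.instance Definition _ :=
  Lmodule_isNormed.Build C l2 l2_normD l2_normZ l2_norm0_eq0.

End SquareSummable.

Arguments l2 : clear implicits.

(* On a Hilbert space, a homomorphism to linear isometries is the same as a
   unitary representation. *)
Record isometric_rep (K : numFieldType) (G : groupType) (V : normedModType K) :=
  IsometricRep {
    rep_op :> G -> {linear V -> V};
    rep_op1 : forall v, rep_op 1%g v = v;
    rep_opM : forall g h v, rep_op (g * h)%g v = rep_op g (rep_op h v);
    rep_op_norm : forall g v, `|rep_op g v| = `|v| }.

Section RegularRepresentation.
Variables (R : realType) (G : groupType).
Implicit Types (g h : G) (f : l2 R G).

Lemma l2_sqnorm_translate g (f : G -> R[i]^o) :
  l2_sqnorm (fun x => f (g^-1 * x)%g) = l2_sqnorm f.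
Proof.
apply/esym/(@reindex_esum _ _ _ [set: G] [set: G] (fun x => g^-1 * x)%g).
rewrite setTT_bijective; exists (fun x => g * x)%g => x; first by rewrite mulVKg.
by rewrite mulKg.
Qed.

Lemma l2_translate_subproof g f :
  (fun x => f (g^-1 * x)%g) \in @square_summable R G.
Proof. rewrite unfold_in l2_sqnorm_translate; exact: l2_funP. Qed.

Definition l2_translate g f : l2 R G := L2 (l2_translate_subproof g f).

Lemma l2_translate_linear g : linear (l2_translate g).
Proof. by move=> c f1 f2; apply: val_inj. Qed.

HB.instance Definition _ g :=
  GRing.isLinear.Build R[i] (l2 R G) (l2 R G) *:%R (l2_translate g)
    (l2_translate_linear g).

Lemma l2_translate1 f : l2_translate 1%g f = f.
Proof. by apply: val_inj; apply/funext => x /=; rewrite invg1 mul1g. Qed.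

Lemma l2_translateM g h f :
  l2_translate (g * h)%g f = l2_translate g (l2_translate h f).
Proof. by apply: val_inj; apply/funext => x /=; rewrite invgM mulgA. Qed.

Lemma l2_translate_norm g f : `|l2_translate g f| = `|f|.
Proof. by congr (Num.sqrt (fine _))%:C%C; exact: l2_sqnorm_translate. Qed.

Definition regular_rep : isometric_rep G (l2 R G) :=
  @IsometricRep R[i] G (l2 R G) (fun g => l2_translate g)
    l2_translate1 l2_translateM l2_translate_norm.

End RegularRepresentation.

Section BoundedCohomology.
Variables (K : numFieldType) (G : groupType) (V : normedModType K).
Variable rho : isometric_rep G V.

(* An (n+1)-tuple of elements of G is a function 'I_n.+1 -> G; precomposing with
   lift i omits the i-th entry. *)
Definition cochain n := ('I_n.+1 -> G) -> V.

Definition cochain_act n (g : G) (f : cochain n) : cochain n :=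
  fun x => rho g (f (fun i => g^-1 * x i)%g).

Definition coboundary n (f : cochain n) : cochain n.+1 :=
  fun x => \sum_(i < n.+2) (-1) ^+ i *: f (fun j => x (lift i j)).

Definition bounded_invariant_cochains n : set (cochain n) :=
  [set f | (exists M, forall x, `|f x| <= M) /\
           forall g, cochain_act g f = f].

Definition bounded_cocycles n : set (cochain n) :=
  [set f | bounded_invariant_cochains f /\ coboundary f = 0].

Definition bounded_coboundaries n : set (cochain n) :=
  match n with
  | 0 => [set 0]
  | m.+1 => @coboundary m @` @bounded_invariant_cochains m
  end.

(* H^n_b = ker / im is zero iff ker = im. *)
Definition bounded_cohomology_vanishes n :=
  @bounded_cocycles n = @bounded_coboundaries n.

End BoundedCohomology.

Section MeasureEquivalence.
Variable R : realType.

(* T is isomorphic to a Polish space with its Borel sigma-algebra; complete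
   metric spaces are rendered as Hausdorff complete pseudometric spaces. *)
Definition standard_borel d (T : measurableType d) :=
  exists P : completePseudoMetricType R,
    [/\ hausdorff_space P, @second_countable P &
      exists2 f : T -> P, bijective f &
        forall A : set T, measurable A <-> <<s [set U : set P | open U] >> (f @` A)].

Section Actions.
Context d (T : measurableType d).
Variable m : {measure set T -> \bar R}.

Definition measure_preserving (f : T -> T) :=
  measurable_fun [set: T] f /\
  forall A, measurable A -> m (f @^-1` A) = m A.

Record measure_preserving_action (G : groupType) (a : G -> T -> T) : Prop :=
  MeasurePreservingAction {
    mp_action1 : forall x, a 1%g x = x;
    mp_actionM : forall g h x, a (g * h)%g x = a g (a h x);
    mp_action_mp : forall g, measure_preserving (a g) }.

(* The translates of Y partition T up to a null set. *)
Definition fundamental_domain (G : groupType) (a : G -> T -> T) (Y : set T) :=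
  measurable Y /\ {ae m, forall x, exists! g, (a g @` Y) x}.

End Actions.

(* The zero measure is excluded: with it, any two groups would be measure
   equivalent. *)
Definition measure_equivalent (G H : groupType) :=
  exists (d : measure_display) (S : measurableType d)
         (m : {measure set S -> \bar R}) (a : G -> S -> S) (b : H -> S -> S),
    [/\ [/\ standard_borel S, sigma_finite [set: S] m & m [set: S] <> 0%E],
        measure_preserving_action m a,
        measure_preserving_action m b,
        (forall g h x, a g (b h x) = b h (a g x)) &
        (exists2 Y, fundamental_domain m a Y & (m Y < +oo)%E) /\
        (exists2 Z, fundamental_domain m b Z & (m Z < +oo)%E)].

End MeasureEquivalence.

(* Main.v *)
Require Import Defs.
From mathcomp Require Import all_boot all_order all_algebra.
From mathcomp Require Import complex.
From mathcomp Require Import all_classical all_reals all_analysis.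
From mathcomp Require finmap.
From mathcomp Require Import measurable_realfun.
From mathcomp Require Import ring lra.

Set Implicit Arguments.
Unset Strict Implicit.
Unset Printing Implicit Defensive.

Import Order.TTheory GRing.Theory Num.Theory.
Import numFieldNormedType.Exports.

Local Open Scope classical_set_scope.
Local Open Scope ring_scope.

(** Why the vanishing passes through a measure equivalence.

    Taking real and imaginary parts, it is enough to treat functions
    c : G -> G -> G -> G -> R, three group variables followed by the coordinate
    in l^2(G) (bounded_cohomology_vanishesP).  The usual argument realises
    bounded cohomology on Poisson boundaries and uses their double ergodicity.
    Here the boundary is replaced by averages over longer and longer random
    walks, so that no limit is needed before one last weak limit.

    Double ergodicity. Let w_n be the Cesaro mean of the first laws of a
    symmetric random walk on G whose finite set of steps grows with n. When
    both variables of a bounded equivariant 1-cochain f with values in l^2(G)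
    are averaged by w_n, the result becomes constant as n grows (average1_cvg).
    Indeed, after averaging one variable f is almost harmonic in it, so its
    squared norm along the walk is almost a bounded submartingale and the mean
    squared increments are almost summable (walk_energy); equivariance and
    symmetry turn the mean over positions of the walk into the average in the
    other variable. Therefore, if H^2_b(G, l^2 G) = 0, the averages of every
    bounded l^2(G)-valued 2-cocycle are asymptotically constant (average2_cvg).

    Induction.  A coupling S carries equivariant maps kappa : S -> G and
    chi : S -> H, whose fibres over 1 are fundamental domains Y and X.  A bounded
    cocycle c on H gives the functions
    y |-> c (chi (g0^-1 y)) (chi (g1^-1 y)) (chi (g2^-1 y)) 1 on S, and the
    integrals of their G-translates over a part A of Y form a cocycle on G.  It
    takes values in l^2(G) because summing over G-translates of Y and summing
    over H-translates of X both exhaust S (sum_Rintegral_unfold).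

    Return.  The prism homotopy compares c l0 l1 l2 with the values of c at the
    elements chi ((kappa (l_i^-1 y) s_i)^-1 y) of H.  Averaging over the s_i and
    integrating over y in Y gives bounded 1-cochains h_n on H such that
    c - d h_n is an integral over Y which, on each of countably many pieces of Y,
    is the average of an induced cocycle on G.  It is thus asymptotically
    independent of l0, l1, l2 (straightened_cvg).  A limit h of the h_n along an
    ultrafilter satisfies c = d h + W where W does not depend on the group
    variables; such a W is the coboundary of itself, so c is a coboundary. *)

(** * Square-summable functions and finite means *)

Lemma countable_enum (K : Type) (x : K) : countable [set: K] ->
  exists (code : K -> nat) (e : nat -> K), cancel code e.
Proof.
move=> /countable_injP[k kI].
exists k, (fun n => if pselect (exists q, k q = n) is left h then projT1 (cid h) else x).
move=> q; case: pselect => [h|[]]; last by exists q.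
by apply: kI; rewrite ?inE//; exact: (projT2 (cid h)).
Qed.

Section SquareSumBound.
Variables (R : realType) (X : eqType).
Implicit Types (C D : R) (phi psi : X -> R).

(** Testing finite families only keeps all estimates inside finite sums; the
    supremum over the families is the squared l^2 norm. *)
Definition l2_le C phi :=
  forall r : seq X, uniq r -> \sum_(x <- r) phi x ^+ 2 <= C.

Lemma l2_le_ge0 C phi : l2_le C phi -> 0 <= C.
Proof. by move=> /(_ [::] isT); rewrite big_nil. Qed.

Lemma l2_le_point C phi x : l2_le C phi -> phi x ^+ 2 <= C.
Proof. by move=> /(_ [:: x] isT); rewrite big_seq1. Qed.

Lemma l2_le_norm C phi x : l2_le C phi -> `|phi x| <= C + 1.
Proof.
move=> h; have C0 := l2_le_ge0 h; move: (l2_le_point x h).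
rewrite -(real_normK (num_real (phi x))); have := normr_ge0 (phi x).
set t := `|_| => t0 tC; rewrite leNgt; apply/negP => ht; nra.
Qed.

Lemma l2_leW C D phi : C <= D -> l2_le C phi -> l2_le D phi.
Proof. by move=> CD h r /h /le_trans; apply. Qed.

Lemma l2_leD C D phi psi : l2_le C phi -> l2_le D psi ->
  l2_le (2 * C + 2 * D) (fun x => phi x + psi x).
Proof.
move=> hC hD r ur; apply: (@le_trans _ _
  (\sum_(x <- r) (2 * phi x ^+ 2 + 2 * psi x ^+ 2))).
  apply: ler_sum => x _; have := sqr_ge0 (phi x - psi x); nra.
by rewrite big_split/= -!mulr_sumr lerD ?ler_pM2l ?hC ?hD.
Qed.

Lemma l2_leN C phi : l2_le C phi -> l2_le C (fun x => - phi x).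
Proof. by move=> h r /h; under eq_bigr do rewrite -sqrrN. Qed.

Lemma l2_leB C D phi psi : l2_le C phi -> l2_le D psi ->
  l2_le (2 * C + 2 * D) (fun x => phi x - psi x).
Proof. by move=> hC hD; apply: l2_leD => //; exact: l2_leN. Qed.

Lemma l2_le_comp C phi (f : X -> X) : injective f -> l2_le C phi ->
  l2_le C (phi \o f).
Proof.
by move=> fI h r ur; have := h (map f r); rewrite big_map map_inj_uniq//; exact.
Qed.

End SquareSumBound.

Section FiniteMean.
Variable R : realType.

(** A finitely supported measure is a list of weighted points, so that means
    commute with integrals and limits by plain linearity. *)
Definition mean (T : Type) (w : seq (R * T)) (phi : T -> R) : R :=
  \sum_(p <- w) p.1 * phi p.2.

Definition is_prob (T : Type) (w : seq (R * T)) :=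
  all (fun p => 0 <= p.1) w /\ mean w (fun=> 1) = 1.

Definition unif (T : Type) (s : seq T) : seq (R * T) :=
  [seq ((size s)%:R^-1, x) | x <- s].

(** Composition of random choices: first a point t by w, then a point by v t. *)
Definition bind (T U : Type) (w : seq (R * T)) (v : T -> seq (R * U)) :=
  [seq (p.1 * q.1, q.2) | p <- w, q <- v p.2].

Section MeanTheory.
Variables (T U : Type).
Implicit Types (w : seq (R * T)) (phi psi : T -> R).

Lemma eq_mean w phi psi : phi =1 psi -> mean w phi = mean w psi.
Proof. by move=> e; apply: eq_bigr => p _; rewrite e. Qed.

Lemma meanD w phi psi :
  mean w (fun t => phi t + psi t) = mean w phi + mean w psi.
Proof. by rewrite -big_split; apply: eq_bigr => p _; rewrite mulrDr. Qed.

Lemma meanZ w a phi : mean w (fun t => a * phi t) = a * mean w phi.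
Proof. by rewrite /mean mulr_sumr; apply: eq_bigr => p _; rewrite mulrCA. Qed.

Lemma meanB w phi psi :
  mean w (fun t => phi t - psi t) = mean w phi - mean w psi.
Proof.
rewrite meanD; congr (_ + _); rewrite -[RHS]mulN1r -meanZ.
by apply: eq_mean => t; rewrite mulN1r.
Qed.

Lemma mean_sum w (I : Type) (r : seq I) (F : I -> T -> R) :
  mean w (fun t => \sum_(i <- r) F i t) = \sum_(i <- r) mean w (F i).
Proof. by rewrite exchange_big; apply: eq_bigr => p _; rewrite mulr_sumr. Qed.

Lemma mean_exchange w (v : seq (R * U)) (F : T -> U -> R) :
  mean w (fun t => mean v (F t)) = mean v (fun u => mean w (F^~ u)).
Proof. by rewrite mean_sum; apply: eq_bigr => q _; rewrite meanZ. Qed.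

Lemma mean_cst w a : is_prob w -> mean w (fun=> a) = a.
Proof.
by move=> [_ w1]; rewrite -[RHS]mulr1 -w1 -meanZ; apply: eq_mean => t; rewrite mulr1.
Qed.

Lemma ler_mean w phi psi : is_prob w -> (forall t, phi t <= psi t) ->
  mean w phi <= mean w psi.
Proof.
move=> [+ _] h; rewrite /mean; elim: w => [|p w IHw]/=; first by rewrite !big_nil.
by move=> /andP[p0 w0]; rewrite !big_cons lerD ?ler_wpM2l// IHw.
Qed.

Lemma mean_ge0 w phi : is_prob w -> (forall t, 0 <= phi t) -> 0 <= mean w phi.
Proof. by move=> wp h; rewrite -[leLHS](mean_cst 0 wp); exact: ler_mean. Qed.

Lemma mean_le_cst w phi a : is_prob w -> (forall t, phi t <= a) -> mean w phi <= a.
Proof. by move=> wp h; rewrite -[leRHS](mean_cst a wp); exact: ler_mean. Qed.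

Lemma mean_jensen w phi : is_prob w ->
  mean w phi ^+ 2 <= mean w (fun t => phi t ^+ 2).
Proof.
move=> wp; set a := mean w phi; rewrite -subr_ge0.
rewrite (_ : _ - _ = mean w (fun t => (phi t - a) ^+ 2)).
  by apply: mean_ge0 => // t; rewrite sqr_ge0.
rewrite (_ : mean w (fun t => (phi t - a) ^+ 2) =
  mean w (fun t => phi t ^+ 2 - (2 * a) * phi t + a ^+ 2)); last first.
  by apply: eq_mean => t; ring.
by rewrite meanD meanB meanZ mean_cst// -/a; ring.
Qed.

Lemma mean_sum_sqr w (I : Type) (r : seq I) (F : I -> T -> R) : is_prob w ->
  \sum_(i <- r) mean w (F i) ^+ 2 <= mean w (fun t => \sum_(i <- r) F i t ^+ 2).
Proof. by move=> wp; rewrite mean_sum; apply: ler_sum => i _; exact: mean_jensen. Qed.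

Lemma mean_unif (s : seq T) phi :
  mean (unif s) phi = (size s)%:R^-1 * \sum_(x <- s) phi x.
Proof. by rewrite /mean big_map mulr_sumr. Qed.

Lemma unif_prob (s : seq T) : (0 < size s)%N -> is_prob (unif s).
Proof.
move=> s0; split; first by rewrite all_map (@eq_all _ _ predT) ?all_predT// => x /=; rewrite invr_ge0 ler0n.
rewrite mean_unif big_const_seq count_predT iter_addr_0 mulVf//.
by rewrite pnatr_eq0 -lt0n.
Qed.

Lemma mean_bind w (v : T -> seq (R * U)) (phi : U -> R) :
  mean (bind w v) phi = mean w (fun t => mean (v t) phi).
Proof.
rewrite /mean /bind big_allpairs_dep; apply: eq_bigr => p _.
by rewrite mulr_sumr; apply: eq_bigr => q _; rewrite mulrA.
Qed.

Lemma bind_prob w (v : T -> seq (R * U)) : is_prob w ->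
  (forall t, is_prob (v t)) -> is_prob (bind w v).
Proof.
move=> wp vp; split; last first.
  by rewrite mean_bind -[RHS](mean_cst 1 wp); apply: eq_mean => t; case: (vp t).
case: wp => w0 _; elim: w w0 => //= p w IHw /andP[p0 w0].
rewrite /bind /= all_cat IHw// andbT all_map; apply: sub_all (vp p.2).1 => q q0 /=.
exact: mulr_ge0.
Qed.

Lemma mean_l2_le (X : eqType) w (F : X -> T -> R) C : is_prob w ->
  (forall t, l2_le C (F^~ t)) -> l2_le C (fun x => mean w (F x)).
Proof.
move=> wp h r ur; apply: le_trans (mean_sum_sqr _ _ wp) _.
by apply: mean_le_cst => // t; exact: h.
Qed.

End MeanTheory.
End FiniteMean.

(** * Random walks and the energy estimate *)

Section RandomWalk.
Variables (R : realType) (G : groupType) (S : seq G).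
Hypotheses (S0 : (0 < size S)%N) (Ssym : perm_eq [seq (s^-1)%g | s <- S] S).

Fixpoint walk k : seq (R * G) :=
  if k is k'.+1 then bind (walk k') (fun g => unif R [seq (g * s)%g | s <- S])
  else [:: (1, 1%g)].

Definition cesaro_walk N : seq (R * G) := bind (unif R (iota 0 N)) walk.

Lemma walk_prob k : is_prob (walk k).
Proof.
elim: k => [|k IHk] /=.
  by split; rewrite /= ?ler01// /mean ?big_seq1/= ?mulr1.
by apply: bind_prob => // g; apply: unif_prob; rewrite size_map.
Qed.

Lemma cesaro_prob N : (0 < N)%N -> is_prob (cesaro_walk N).
Proof.
by move=> N0; apply: bind_prob; [apply: unif_prob; rewrite size_iota|exact: walk_prob].
Qed.

Lemma mean_walk0 phi : mean (walk 0) phi = phi 1%g.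
Proof. by rewrite /mean big_seq1 mul1r. Qed.

Lemma mean_walkS k phi :
  mean (walk k.+1) phi = mean (walk k) (fun g => mean (unif R S) (fun s => phi (g * s)%g)).
Proof.
rewrite mean_bind; apply: eq_mean => g.
by rewrite !mean_unif size_map big_map.
Qed.

Lemma mean_walkSl k phi :
  mean (walk k.+1) phi = mean (unif R S) (fun s => mean (walk k) (fun g => phi (s * g)%g)).
Proof.
elim: k phi => [|k IHk] phi.
  rewrite mean_walkS mean_walk0; apply: eq_mean => s.
  by rewrite mean_walk0 mul1g mulg1.
rewrite mean_walkS IHk; apply: eq_mean => s; rewrite mean_walkS; apply: eq_mean => g.
by apply: eq_mean => t; rewrite mulgA.
Qed.

(** The reversal of a path turns right steps into left steps and inverts the
    increments, and S is symmetric. *)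
Lemma mean_walkV k phi : mean (walk k) (fun g => phi (g^-1)%g) = mean (walk k) phi.
Proof.
elim: k phi => [|k IHk] phi; first by rewrite !mean_walk0 invg1.
rewrite mean_walkS mean_walkSl mean_exchange.
rewrite !mean_unif -(perm_big _ Ssym)/= big_map; congr (_ * _).
apply: eq_bigr => s _; rewrite -(IHk (fun g => phi (s * g)%g)).
by apply: eq_mean => g; rewrite invgM invgK.
Qed.

Lemma mean_cesaro N phi :
  mean (cesaro_walk N) phi = N%:R^-1 * \sum_(0 <= k < N) mean (walk k) phi.
Proof. by rewrite mean_bind mean_unif size_iota /index_iota subn0. Qed.

Lemma mean_cesaroV N phi :
  mean (cesaro_walk N) (fun g => phi (g^-1)%g) = mean (cesaro_walk N) phi.
Proof.
by rewrite !mean_cesaro; congr (_ * _); apply: eq_bigr => k _; exact: mean_walkV.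
Qed.

(** The Cesaro mean is almost invariant under one step, on either side: the sum
    over times telescopes. *)
Lemma mean_cesaro_stepr N phi :
  mean (cesaro_walk N) (fun g => mean (unif R S) (fun s => phi (g * s)%g) - phi g) =
  N%:R^-1 * (mean (walk N) phi - phi 1%g).
Proof.
rewrite mean_cesaro -(mean_walk0 phi) -(telescope_sumr (fun k => mean (walk k) phi) (leq0n N)); congr (_ * _).
by apply: eq_bigr => k _; rewrite meanB -mean_walkS.
Qed.

Lemma mean_cesaro_stepl N phi :
  mean (unif R S) (fun s => mean (cesaro_walk N) (fun g => phi (s * g)%g)) -
    mean (cesaro_walk N) phi =
  N%:R^-1 * (mean (walk N) phi - phi 1%g).
Proof.
rewrite mean_exchange -meanB mean_cesaro -(mean_walk0 phi) -(telescope_sumr (fun k => mean (walk k) phi) (leq0n N)).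
congr (_ * _); apply: eq_bigr => k _.
by rewrite meanB mean_exchange -mean_walkSl.
Qed.

Section Estimate.
Variables (f : G -> G -> R) (C : R) (N : nat) (r : seq G).
Hypotheses (N0 : (0 < N)%N) (ur : uniq r) (fC : forall b, l2_le C (f b)).

Let Phi b z := mean (cesaro_walk N) (fun t => f (b * t)%g z).

Let PhiC b : l2_le C (Phi b).
Proof. by apply: mean_l2_le => [|t]; [exact: cesaro_prob|exact: fC]. Qed.

(** Phi is the average of f in its group variable, hence harmonic up to O(1/N).
    Expanding the square, the mean squared increment at u equals
    P psi u - psi u, with psi the squared norm of Phi and P the step operator,
    up to the defect of harmonicity.  The mean of P psi - psi over the walk
    telescopes, and psi is bounded by C. *)
Lemma walk_energy :
  mean (cesaro_walk N) (fun u => mean (unif R S) (fun s =>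
     \sum_(z <- r) (Phi (u * s)%g z - Phi u z) ^+ 2)) <= 5 * C / N%:R.
Proof.
pose psi b := \sum_(z <- r) Phi b z ^+ 2.
have psi0 b : 0 <= psi b by apply: sumr_ge0 => z _; rewrite sqr_ge0.
have N0' : 0 < N%:R^-1 :> R by rewrite invr_gt0 ltr0n.
have Sp := unif_prob R S0.
have key u : mean (unif R S) (fun s =>
     \sum_(z <- r) (Phi (u * s)%g z - Phi u z) ^+ 2) <=
   mean (unif R S) (fun s => psi (u * s)%g) - psi u + 4 * C / N%:R.
  pose q z := mean (walk N) (fun t => f (u * t)%g z).
  have stepE z : mean (unif R S) (fun s => Phi (u * s)%g z - Phi u z) =
      N%:R^-1 * (q z - f u z).
    rewrite meanB mean_cst// -[in f u z](mulg1 u) -(mean_cesaro_stepl N (fun t => f (u * t)%g z)).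
    congr (_ - _); apply: eq_mean => s; apply: eq_mean => t.
    by rewrite mulgA.
  have qC : l2_le C q by apply: mean_l2_le => [|t]; [exact: walk_prob|exact: fC].
  rewrite [leLHS](_ : _ = mean (unif R S) (fun s => psi (u * s)%g) - psi u +
    \sum_(z <- r) (- 2 * Phi u z * (N%:R^-1 * (q z - f u z)))).
    rewrite lerD2l.
    apply: (@le_trans _ _ (\sum_(z <- r) N%:R^-1 *
       (2 * Phi u z ^+ 2 + q z ^+ 2 + f u z ^+ 2))).
      apply: ler_sum => z _; rewrite mulrCA ler_pM2l//.
      have := sqr_ge0 (Phi u z + q z); have := sqr_ge0 (Phi u z - f u z); nra.
    rewrite -mulr_sumr mulrC ler_pM2r// !big_split/= -mulr_sumr.
    have := PhiC u ur; have := qC _ ur; have := fC u ur; lra.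
  rewrite (_ : psi u = mean (unif R S) (fun=> psi u)); last by rewrite mean_cst.
  rewrite -meanB; under [X in _ = _ + X]eq_bigr => z _ do
    rewrite -stepE -meanZ.
  rewrite -mean_sum -meanD; apply: eq_mean => s.
  rewrite /psi -sumrB -big_split/=; apply: eq_bigr => z _; ring.
apply: (le_trans (ler_mean (cesaro_prob N0) key)).
rewrite meanD (mean_cst _ (cesaro_prob N0)) (mean_cesaro_stepr N psi).
have : mean (walk N) psi <= C.
  by apply: mean_le_cst => [|u]; [exact: walk_prob|exact: PhiC].
have h1 := psi0 1%g; move=> h2.
have : N%:R^-1 * (mean (walk N) psi - psi 1%g) <= N%:R^-1 * C.
  by rewrite ler_pM2l//; lra.
lra.
Qed.

End Estimate.
End RandomWalk.

(** * Asymptotic double ergodicity *)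

Section DoubleErgodicity.
Variables (R : realType) (G : groupType).

(** The last variable is the coordinate of a value in l^2(G). *)
Definition equivariant1 (f : G -> G -> G -> R) :=
  forall g a b x, f (g * a)%g (g * b)%g (g * x)%g = f a b x.

Definition average1 (w : seq (R * G)) (f : G -> G -> G -> R) a b x :=
  mean w (fun s => mean w (fun t => f (a * s)%g (b * t)%g x)).

Lemma average1_equivariant w f : equivariant1 f -> equivariant1 (average1 w f).
Proof.
move=> finv g a b x; apply: eq_mean => s; apply: eq_mean => t.
by rewrite -!mulgA finv.
Qed.

Section Quantitative.
Variables (S : seq G) (N : nat) (f : G -> G -> G -> R) (C : R).
Hypotheses (S0 : (0 < size S)%N) (Ssym : perm_eq [seq (s^-1)%g | s <- S] S).
Hypotheses (N0 : (0 < N)%N) (finv : equivariant1 f).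
Hypothesis fC : forall a b, l2_le C (f a b).

(** By equivariance, moving the first variable by u amounts to looking at the
    last ones from u^-1; by symmetry of the walk u^-1 may be replaced by u.  The
    difference of the averages is then a mean, over positions u of the walk, of
    increments of Phi along s, which the energy estimate controls. *)
Lemma average1_near (s x : G) : s \in S ->
  (average1 (cesaro_walk R S N) f 1 s x - average1 (cesaro_walk R S N) f 1 1 x) ^+ 2 <=
  5 * C / N%:R * (size S)%:R.
Proof.
move=> sS; set w := cesaro_walk R S N.
have wp : is_prob w by exact: cesaro_prob.
pose Phi b z := mean w (fun t => f 1%g (b * t)%g z).
have avgE b : average1 w f 1 b x = mean w (fun u => Phi (u * b)%g (u * x)%g).
  rewrite -mean_cesaroV//; apply: eq_mean => u; apply: eq_mean => t.
  by rewrite mul1g -[in LHS](finv (u^-1)%g) mulVg mulgA.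
(* A finite set of coordinates that contains all those met below. *)
pose r := undup [seq (p.2 * x)%g | p <- w].
pose d u s' := \sum_(z <- r) (Phi (u * s')%g z - Phi u z) ^+ 2.
have d0 u s' : 0 <= d u s' by apply: sumr_ge0 => z _; rewrite sqr_ge0.
have := walk_energy S0 N0 (undup_uniq [seq (p.2 * x)%g | p <- w]) (fC 1%g).
rewrite -/w -/r => energy.
rewrite !avgE -meanB; apply: le_trans (mean_jensen _ wp) _.
apply: (@le_trans _ _ (mean w (fun u => (size S)%:R * mean (unif R S) (d u)))).
  rewrite /mean big_seq [leRHS]big_seq; apply: ler_sum => p pw.
  apply: ler_wpM2l; first by case: wp => /allP/(_ _ pw).
  rewrite mulg1; apply: (@le_trans _ _ (d p.2 s)).
    rewrite /d (bigD1_seq (p.2 * x)%g) ?undup_uniq//=.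
      by rewrite lerDl sumr_ge0// => z _; rewrite sqr_ge0.
    by rewrite mem_undup; apply/mapP; exists p.
  rewrite -/(mean (unif R S) (d p.2)) mean_unif mulVKf ?pnatr_eq0 -?lt0n//.
  by rewrite (big_rem s)//= lerDl sumr_ge0.
by rewrite meanZ mulrC ler_pM2r// ltr0n.
Qed.

End Quantitative.

(** The walk at stage n uses the first n + 1 elements of G and their inverses,
    and runs for (n + 1)^2 steps: the number of steps outgrows the factor size S in
    average1_near.  Both diagonals f(a, a) and f(b, b) approximate f(a, b), by
    the symmetric roles of the variables, so all values share one limit. *)
Lemma average1_cvg : countable [set: G] ->
  exists w : nat -> seq (R * G), (forall n, is_prob (w n)) /\
  forall f C, equivariant1 f -> (forall a b, l2_le C (f a b)) ->
  forall a b x,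
    average1 (w n) f a b x - average1 (w n) f 1 1 x @[n --> \oo] --> (0 : R).
Proof.
move=> /(countable_enum 1%g)[k [e eK]].
pose T n := [seq e i | i <- iota 0 n.+1].
pose S n := T n ++ [seq (s^-1)%g | s <- T n].
have S0 n : (0 < size (S n))%N by rewrite size_cat size_map size_iota.
have Ssym n : perm_eq [seq (s^-1)%g | s <- S n] (S n).
  by rewrite /S map_cat (mapK (@invgK G)) perm_catC.
pose w n := cesaro_walk R (S n) (n.+1 ^ 2).
exists w; split=> [n|]; first by apply: cesaro_prob; rewrite ?expn_gt0.
have near1 f C : equivariant1 f -> (forall a b, l2_le C (f a b)) -> forall a b x,
    average1 (w n) f a b x - average1 (w n) f a a x @[n --> \oo] --> (0 : R).
  move=> finv fC a b x.
  set s := (a^-1 * b)%g; set y := (a^-1 * x)%g.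
  have avgE n c : average1 (w n) f a c x = average1 (w n) f 1 (a^-1 * c)%g y.
    by rewrite -(average1_equivariant _ finv (a^-1)%g) mulVg.
  under eq_fun do rewrite !avgE mulVg -/s.
  apply: norm_cvg0; apply: (@squeeze_cvgr _ _ _ _ (fun=> 0) 
     (fun n => Num.sqrt (10 * C * harmonic n))).
  - exists (k s) => // n /= kn; rewrite normr_ge0/= -sqrtr_sqr ler_wsqrtr//.
    have N0 : (0 < n.+1 ^ 2)%N by rewrite expn_gt0.
    apply: le_trans (average1_near (S0 n) (Ssym n) N0 finv fC y _) _.
      rewrite mem_cat; apply/orP; left; apply/mapP; exists (k s); last by rewrite eK.
      by rewrite mem_iota.
    rewrite size_cat !size_map size_iota /harmonic/= addnn -muln2 natrM natrX.
    have n0 : n.+1%:R != 0 :> R by rewrite pnatr_eq0.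
    by rewrite le_eqVlt; apply/orP; left; apply/eqP; field.
  - exact: cvg_cst.
  - suff : Num.sqrt (10 * C * harmonic n) @[n --> \oo] --> Num.sqrt (0 : R).
      by rewrite sqrtr0.
    apply: continuous_cvg; first exact: sqrt_continuous.
    suff : 10 * C * harmonic n @[n --> \oo] --> 10 * C * (0 : R) by rewrite mulr0.
    by apply: cvgM; [exact: cvg_cst|exact: cvg_harmonic].
move=> f C finv fC a b x.
have n1 := near1 f C finv fC.
have swapE n c d : average1 (w n) (fun a b => f b a) c d x = average1 (w n) f d c x.
  by rewrite /average1 mean_exchange.
have n2 c d : average1 (w n) f c d x - average1 (w n) f d d x @[n --> \oo] --> (0 : R).
  have := near1 (fun a b => f b a) C (fun g a b x => finv g b a x)
    (fun a b => fC b a) d c x.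
  by under eq_fun do rewrite !swapE.
have := cvgD (cvgB (n1 1%g b x) (n2 1%g b)) (n2 a b).
rewrite subr0 addr0 => h.
have splitE n : average1 (w n) f a b x - average1 (w n) f 1 1 x =
  average1 (w n) f 1 b x - average1 (w n) f 1 1 x -
  (average1 (w n) f 1 b x - average1 (w n) f b b x) +
  (average1 (w n) f a b x - average1 (w n) f b b x) by ring.
under eq_fun do rewrite splitE; exact: h.
Qed.

End DoubleErgodicity.

Section RealCohomology.
Variables (R : realType) (G : groupType).
Implicit Types (f : G -> G -> G -> R) (c : G -> G -> G -> G -> R).

Definition equivariant2 c :=
  forall g x y z t, c (g * x)%g (g * y)%g (g * z)%g (g * t)%g = c x y z t.

Definition cocycle2 c := forall x y z u t,
  c y z u t - c x z u t + c x y u t - c x y z t = 0.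

Definition coboundary1 f x y z t : R := f y z t - f x z t + f x y t.

Definition real_H2b_vanishes := forall c C, equivariant2 c ->
  (forall x y z, l2_le C (c x y z)) -> cocycle2 c ->
  exists f D, [/\ equivariant1 f, forall x y, l2_le D (f x y) &
    forall x y z t, c x y z t = coboundary1 f x y z t].

Definition average2 (w : seq (R * G)) c x y z t :=
  mean w (fun s0 => mean w (fun s1 => mean w (fun s2 =>
    c (x * s0)%g (y * s1)%g (z * s2)%g t))).

Lemma average2_coboundary w f x y z t : is_prob w ->
  average2 w (coboundary1 f) x y z t = coboundary1 (average1 w f) x y z t.
Proof.
move=> wp; rewrite /average2 /coboundary1 /average1.
rewrite -[X in _ = X - _ + _](mean_cst _ wp) -meanB -meanD.
apply: eq_mean => s0; rewrite -[X in _ = _ - X + _](mean_cst _ wp) -meanB -meanD.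
apply: eq_mean => s1; rewrite -[X in _ = _ + X](mean_cst _ wp) -meanB -meanD.
by [].
Qed.

(** A bounded cocycle is the coboundary of some f; averaging commutes with the
    coboundary, and the three averages of f have a common asymptotic value. *)
Lemma average2_cvg : countable [set: G] -> real_H2b_vanishes ->
  exists w : nat -> seq (R * G), (forall n, is_prob (w n)) /\
  forall c C, equivariant2 c -> (forall x y z, l2_le C (c x y z)) -> cocycle2 c ->
  forall x y z t,
    average2 (w n) c x y z t - average2 (w n) c 1 1 1 t @[n --> \oo] --> (0 : R).
Proof.
move=> cG van; have [w [wp wP]] := average1_cvg R cG.
exists w; split=> // c C cinv cC cc x y z t.
have [f [D [finv fD fE]]] := van c C cinv cC cc.
have avgE n p q r : average2 (w n) c p q r t = coboundary1 (average1 (w n) f) p q r t.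
  rewrite -average2_coboundary//; do 3 (apply: eq_mean => ?).
  exact: fE.
have h p q := wP f D finv fD p q t.
have H := cvgD (cvgB (h y z) (h x z)) (h x y); rewrite subr0 addr0 in H.
have splitE n : average2 (w n) c x y z t - average2 (w n) c 1 1 1 t =
  (average1 (w n) f y z t - average1 (w n) f 1 1 t) -
  (average1 (w n) f x z t - average1 (w n) f 1 1 t) +
  (average1 (w n) f x y t - average1 (w n) f 1 1 t).
  by rewrite !avgE /coboundary1; ring.
under eq_fun do rewrite splitE; exact: H.
Qed.

End RealCohomology.

(** * Bounded functions on a measure space *)

Section DiscreteValued.
Context d (S : measurableType d).

(** Measurability for a map to a countable set, without any sigma-algebra on
    the target. *)
Definition level_measurable (K : Type) (k : S -> K) :=
  forall q, measurable [set y | k y = q].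

Lemma level_measurable_preimage (K : Type) (k : S -> K) (P : set K) :
  countable [set: K] -> level_measurable k -> measurable [set y | P (k y)].
Proof.
move=> cK mk.
rewrite (_ : [set _ | _] = \bigcup_q ([set y | k y = q] `&` [set _ | P q])).
  apply: countable_bigcupT_measurable => // q; apply: measurableI => //.
  have [Pq|nPq] := pselect (P q).
    by rewrite (_ : [set _ | _] = setT)//; apply/seteqP; split.
  by rewrite (_ : [set _ | _] = set0)//; apply/seteqP; split.
apply/seteqP; split => [y /= Py|y [q _ [/= ->]]//].
by exists (k y).
Qed.

Lemma level_measurable_fun (R : realType) (K : Type) (k : S -> K) (F : K -> R) :
  countable [set: K] -> level_measurable k ->
  measurable_fun [set: S] (fun y => F (k y)).
Proof.
move=> cK mk _ Y mY; rewrite setTI.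
exact: (level_measurable_preimage (F @^-1` Y)).
Qed.

Lemma level_measurable_pair (K L : Type) (k : S -> K) (l : S -> L) :
  level_measurable k -> level_measurable l ->
  level_measurable (fun y => (k y, l y)).
Proof.
move=> mk ml [p q].
rewrite (_ : [set _ | _] = [set y | k y = p] `&` [set y | l y = q]).
  exact: measurableI.
by apply/seteqP; split=> y /= [kp lq]; rewrite ?kp ?lq.
Qed.

Lemma level_measurable_comp (K : Type) (k : S -> K) (T : S -> S) :
  measurable_fun [set: S] T -> level_measurable k ->
  level_measurable (fun y => k (T y)).
Proof. by move=> mT mk q; have := mT measurableT _ (mk q); rewrite setTI. Qed.

Lemma level_measurable_bind (K L : Type) (k : S -> K) (l : K -> S -> L) :
  countable [set: K] -> level_measurable k ->
  (forall p, level_measurable (l p)) ->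
  level_measurable (fun y => l (k y) y).
Proof.
move=> cK mk ml q.
rewrite (_ : [set _ | _] = \bigcup_p ([set y | k y = p] `&` [set y | l p y = q])).
  by apply: countable_bigcupT_measurable => // p; apply: measurableI; [exact: mk|exact: ml].
apply/seteqP; split => [y /= ly|y [p _ [/= ->]]//].
by exists (k y).
Qed.

End DiscreteValued.

Lemma countable_pair (K L : Type) :
  countable [set: K] -> countable [set: L] -> countable [set: K * L].
Proof. by move=> cK cL; rewrite -setXTT; exact: countableX. Qed.

Section BoundedIntegral.
Context d (S : measurableType d) (R : realType).
Variable m : {measure set S -> \bar R}.
Implicit Types (A B : set S) (phi psi : S -> R).

Definition bounded_measurable C phi :=
  measurable_fun [set: S] phi /\ forall y, `|phi y| <= C.

Definition finite_measurable A := measurable A /\ (m A < +oo)%E.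

Lemma finite_measurableS A B : measurable A -> A `<=` B ->
  finite_measurable B -> finite_measurable A.
Proof.
move=> mA AB [mB Boo]; split => //; apply: le_lt_trans Boo.
by apply: le_measure; rewrite ?inE.
Qed.

Lemma finite_measurableI A B : measurable B -> finite_measurable A ->
  finite_measurable (A `&` B).
Proof.
move=> mB fA; apply: (finite_measurableS _ _ fA); last exact: subIsetl.
by apply: measurableI => //; case: fA.
Qed.

Lemma bounded_measurable_integrable C A phi : finite_measurable A ->
  bounded_measurable C phi -> m.-integrable A (EFin \o phi).
Proof.
move=> [mA Aoo] [mphi phiC]; apply: measurable_bounded_integrable => //.
  exact: measurable_funTS.
exists C; split; first exact: num_real.
by move=> t Ct x _ /=; exact: le_trans (phiC x) (ltW Ct).
Qed.

Lemma bounded_measurableD C D phi psi : bounded_measurable C phi ->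
  bounded_measurable D psi -> bounded_measurable (C + D) (fun y => phi y + psi y).
Proof.
move=> [m1 h1] [m2 h2]; split; first exact: measurable_funD.
by move=> y; apply: le_trans (ler_normD _ _) _; exact: lerD.
Qed.

Lemma bounded_measurableN C phi : bounded_measurable C phi ->
  bounded_measurable C (fun y => - phi y).
Proof.
move=> [m1 h1]; split; first exact: measurableT_comp.
by move=> y; rewrite normrN.
Qed.

Lemma bounded_measurableB C D phi psi : bounded_measurable C phi ->
  bounded_measurable D psi -> bounded_measurable (C + D) (fun y => phi y - psi y).
Proof. by move=> h1 h2; apply: bounded_measurableD => //; exact: bounded_measurableN. Qed.

Lemma bounded_measurable_cst a : bounded_measurable `|a| (fun=> a).
Proof. by split. Qed.

Lemma bounded_measurableZ C a phi : bounded_measurable C phi ->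
  bounded_measurable (`|a| * C) (fun y => a * phi y).
Proof.
move=> [m1 h1]; split; first exact: measurable_funM.
by move=> y; rewrite normrM ler_wpM2l.
Qed.

Lemma bounded_measurable_sqr C phi : bounded_measurable C phi ->
  bounded_measurable (C ^+ 2) (fun y => phi y ^+ 2).
Proof.
move=> [m1 h1]; split; first exact: measurable_funX.
move=> y; have h := h1 y; have C0 := le_trans (normr_ge0 _) h.
by rewrite normrX lerXn2r// nnegrE.
Qed.

Lemma bounded_measurable_comp C phi (T : S -> S) : measurable_fun [set: S] T ->
  bounded_measurable C phi -> bounded_measurable C (fun y => phi (T y)).
Proof. by move=> mT [m1 h1]; split => //; exact: measurableT_comp. Qed.

Lemma bounded_measurable_sum (I : Type) (r : seq I) (C : I -> R) (F : I -> S -> R) :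
  (forall i, bounded_measurable (C i) (F i)) ->
  bounded_measurable (\sum_(i <- r) C i) (fun y => \sum_(i <- r) F i y).
Proof.
move=> h; split; first by apply: measurable_sum => i; case: (h i).
move=> y; apply: le_trans (ler_norm_sum _ _ _) _; apply: ler_sum => i _.
by case: (h i).
Qed.

Lemma bounded_measurable_mean (T : Type) (w : seq (R * T)) C (F : T -> S -> R) :
  is_prob w -> (forall t, bounded_measurable C (F t)) ->
  bounded_measurable C (fun y => mean w (F^~ y)).
Proof.
move=> wp h; split.
  by apply: measurable_sum => p; apply: measurable_funM => //; case: (h p.2).
move=> y; have b t : - C <= F t y <= C by rewrite -ler_norml; case: (h t).
rewrite ler_norml; apply/andP; split; last first.
  by apply: mean_le_cst => // t; case/andP: (b t).
rewrite -[leLHS](mean_cst _ wp); apply: ler_mean => // t; by case/andP: (b t).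
Qed.

Section OnFiniteSet.
Variable A : set S.
Hypothesis fA : finite_measurable A.
Local Notation I phi := (Rintegral m A phi).

Let mA : measurable A := fA.1.

Lemma Rintegral_boundedB C D phi psi : bounded_measurable C phi ->
  bounded_measurable D psi -> I (fun y => phi y - psi y) = I phi - I psi.
Proof.
move=> h1 h2; apply: RintegralB => //.
  exact: bounded_measurable_integrable h1.
exact: bounded_measurable_integrable h2.
Qed.

Lemma Rintegral_boundedD C D phi psi : bounded_measurable C phi ->
  bounded_measurable D psi -> I (fun y => phi y + psi y) = I phi + I psi.
Proof.
move=> h1 h2; apply: RintegralD => //.
  exact: bounded_measurable_integrable h1.
exact: bounded_measurable_integrable h2.
Qed.

Lemma Rintegral_boundedZ C a phi : bounded_measurable C phi ->
  I (fun y => a * phi y) = a * I phi.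
Proof.
by move=> h1; apply: RintegralZl => //; exact: bounded_measurable_integrable h1.
Qed.

Lemma le_Rintegral_bounded C D phi psi : bounded_measurable C phi ->
  bounded_measurable D psi -> (forall y, A y -> phi y <= psi y) -> I phi <= I psi.
Proof.
move=> h1 h2; apply: le_Rintegral => //.
  exact: bounded_measurable_integrable h1.
exact: bounded_measurable_integrable h2.
Qed.

Lemma Rintegral_bounded_norm C phi : bounded_measurable C phi ->
  `|I phi| <= C * fine (m A).
Proof.
move=> h1; have b y : - C <= phi y <= C by rewrite -ler_norml; case: h1.
rewrite ler_norml -mulNr -!Rintegral_cst//; apply/andP; split.
  by apply: (le_Rintegral_bounded (bounded_measurable_cst _) h1) => y _; case/andP: (b y).
by apply: (le_Rintegral_bounded h1 (bounded_measurable_cst _)) => y _; case/andP: (b y).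
Qed.

Lemma Rintegral_bounded_sum (J : Type) (r : seq J) (C : J -> R) (F : J -> S -> R) :
  (forall j, bounded_measurable (C j) (F j)) ->
  I (fun y => \sum_(j <- r) F j y) = \sum_(j <- r) I (F j).
Proof.
move=> h; elim: r => [|j r IHr].
  rewrite big_nil; under eq_Rintegral do rewrite big_nil.
  by rewrite Rintegral_cst// mul0r.
rewrite big_cons -IHr; under eq_Rintegral do rewrite big_cons.
exact: Rintegral_boundedD (h j) (bounded_measurable_sum r h).
Qed.

Lemma Rintegral_mean (T : Type) (w : seq (R * T)) C (F : T -> S -> R) :
  (forall t, bounded_measurable C (F t)) ->
  I (fun y => mean w (F^~ y)) = mean w (fun t => I (F t)).
Proof.
move=> h; rewrite /mean.
rewrite (@Rintegral_bounded_sum _ w (fun p => `|p.1| * C) (fun p y => p.1 * F p.2 y)).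
  by apply: eq_bigr => p _; rewrite (Rintegral_boundedZ _ (h p.2)).
by move=> p; exact: bounded_measurableZ.
Qed.

Lemma Rintegral_cauchy_schwarz C phi : bounded_measurable C phi ->
  I phi ^+ 2 <= fine (m A) * I (fun y => phi y ^+ 2).
Proof.
move=> h1; have h2 := bounded_measurable_sqr h1; set a := fine (m A).
have a0 : 0 <= a by rewrite fine_ge0.
have [a00|a_neq0] := eqVneq a 0.
  have := Rintegral_bounded_norm h1; rewrite -/a a00 mulr0 normr_le0 => /eqP ->.
  by rewrite expr0n mul0r.
pose t := I phi / a.
have : 0 <= I (fun y => (phi y - t) ^+ 2) by apply: Rintegral_ge0 => y _; rewrite sqr_ge0.
have -> : I (fun y => (phi y - t) ^+ 2) = I (fun y => phi y ^+ 2) - 2 * t * I phi + t ^+ 2 * a.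
  rewrite -(Rintegral_boundedZ _ h1) -(Rintegral_boundedB h2 (bounded_measurableZ _ h1)).
  rewrite -Rintegral_cst// -(Rintegral_boundedD
    (bounded_measurableB h2 (bounded_measurableZ _ h1)) (bounded_measurable_cst _)).
  by apply: eq_Rintegral => y _; ring.
have ap : 0 < a by rewrite lt_neqAle eq_sym a_neq0.
have ta : t * a = I phi by rewrite /t divfK.
rewrite -ta; set J := I _; nra.
Qed.

(** Cauchy-Schwarz in each coordinate, then the sum is taken under the
    integral: the integral over A of a bounded l^2-valued
    function is again in l^2. *)
Lemma Rintegral_square_sum (J : Type) (r : seq J) C D (F : J -> S -> R) :
  (forall j, bounded_measurable C (F j)) ->
  (forall y, A y -> \sum_(j <- r) F j y ^+ 2 <= D) ->
  \sum_(j <- r) I (F j) ^+ 2 <= fine (m A) * (D * fine (m A)).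
Proof.
move=> h hD; apply: (@le_trans _ _ (\sum_(j <- r) fine (m A) * I (fun y => F j y ^+ 2))).
  by apply: ler_sum => j _; exact: Rintegral_cauchy_schwarz (h j).
have h2 j := bounded_measurable_sqr (h j).
rewrite -mulr_sumr ler_wpM2l ?fine_ge0// -(Rintegral_bounded_sum r h2).
rewrite -Rintegral_cst//.
exact: le_Rintegral_bounded (bounded_measurable_sum r h2) (bounded_measurable_cst _) hD.
Qed.

End OnFiniteSet.

Lemma Rintegral_boundedU C A B phi : finite_measurable A -> finite_measurable B ->
  A `&` B = set0 -> bounded_measurable C phi ->
  \int[m]_(y in A `|` B) phi y = \int[m]_(y in A) phi y + \int[m]_(y in B) phi y.
Proof.
move=> fA fB AB h; have [mA Aoo] := fA; have [mB Boo] := fB.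
apply: Rintegral_setU => //; last by rewrite disj_set2E AB eqxx.
apply: bounded_measurable_integrable h; split; first exact: measurableU.
by apply: le_lt_trans (measureU2 _ _ _) _ => //; exact: lte_add_pinfty.
Qed.

Lemma le_Rintegral_set C A B phi : finite_measurable B -> measurable A ->
  A `<=` B -> bounded_measurable C phi -> (forall y, 0 <= phi y) ->
  \int[m]_(y in A) phi y <= \int[m]_(y in B) phi y.
Proof.
move=> fB mA AB h phi0.
have fA := finite_measurableS mA AB fB.
have fBA : finite_measurable (B `\` A).
  apply: (finite_measurableS _ _ fB); last exact: subDsetl.
  by apply: measurableD => //; case: fB.
rewrite -(setDUK AB) (Rintegral_boundedU fA fBA _ h) ?setDIK//.
by rewrite lerDl; exact: Rintegral_ge0.
Qed.

Lemma Rintegral_measure_preserving C A phi (T : S -> S) : measure_preserving m T ->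
  finite_measurable A -> bounded_measurable C phi ->
  \int[m]_(y in A) phi y = \int[m]_(y in T @^-1` A) phi (T y).
Proof.
move=> [mT mpT] [mA Aoo] [mphi phiC]; rewrite /Rintegral; congr fine.
have mphi' : measurable_fun [set: S] (EFin \o phi) by exact/measurable_EFinP.
rewrite -[RHS](integral_pushforward mT mphi')//.
  by apply: eq_measure_integral => B mB BA; exact: esym (mpT _ mB).
apply: (@bounded_measurable_integrable C _ (phi \o T)).
  split; first by have := mT measurableT _ mA; rewrite setTI.
  by rewrite mpT.
exact: (@bounded_measurable_comp C phi).
Qed.

Section Exhaustion.
Variables (A : set S) (k : S -> nat).
Hypotheses (fA : finite_measurable A) (mk : level_measurable k).

Let mkP (P : set nat) : measurable [set y | P (k y)].
Proof. exact: level_measurable_preimage. Qed.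

Lemma Rintegral_partial C phi J : bounded_measurable C phi ->
  \int[m]_(y in A `&` [set y | (k y < J)%N]) phi y =
  \sum_(0 <= j < J) \int[m]_(y in A `&` [set y | k y = j]) phi y.
Proof.
move=> h; elim: J => [|J IHJ].
  rewrite big_nil (_ : _ `&` _ = set0) ?Rintegral_set0//.
  by apply/seteqP; split => // y [].
rewrite big_nat_recr//= -IHJ -(Rintegral_boundedU _ _ _ h).
- congr Rintegral; rewrite -setIUr; congr (_ `&` _).
  apply/seteqP; split => y /=; last by case=> [/leqW//|->].
  by rewrite ltnS; case: ltngtP => // kJ _; [left|right].
- by apply: finite_measurableI fA; exact: (mkP [set i | (i < J)%N]).
- by apply: finite_measurableI fA; exact: mk.
- by apply/seteqP; split => // y [[_ /= h1] [_ /= h2]]; move: h1; rewrite h2 ltnn.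
Qed.

(** The error is at most C times the measure of the part of A where k is at
    least J, which decreases to zero; in particular it is uniform in phi. *)
Lemma Rintegral_exhaustion : exists2 tau : nat -> R, tau @ \oo --> 0 &
  forall C phi J, bounded_measurable C phi ->
  `|\int[m]_(y in A) phi y -
    \int[m]_(y in A `&` [set y | (k y < J)%N]) phi y| <= C * tau J.
Proof.
pose B J := A `&` [set y | (J <= k y)%N].
have fB J : finite_measurable (B J).
  by apply: finite_measurableI fA; exact: (mkP [set i | (J <= i)%N]).
exists (fun J => fine (m (B J))).
  apply: fine_cvg; suff : m \o B @ \oo --> m (\bigcap_J B J).
    rewrite (_ : \bigcap_J B J = set0) ?measure0//.
    apply/seteqP; split => // y By; have [_ /=] := By (k y).+1 I.
    by rewrite ltnn.
  apply: nonincreasing_cvg_mu => //.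
  - by have [] := fB 0%N.
  - by move=> J; have [] := fB J.
  - by apply: bigcapT_measurable => J; have [] := fB J.
  - move=> i j ij; apply/subsetPset => y [Ay /= jy]; split => //=.
    exact: leq_trans jy.
move=> C phi J h.
have AE : A = (A `&` [set y | (k y < J)%N]) `|` B J.
  rewrite -setIUr; apply/seteqP; split => [y Ay|y []//]; split => //=.
  by have [|] := ltnP (k y) J; [left|right].
rewrite {1}AE (Rintegral_boundedU _ _ _ h)//.
- by rewrite addrAC subrr add0r; exact: Rintegral_bounded_norm.
- by apply: finite_measurableI fA; exact: (mkP [set i | (i < J)%N]).
- apply/seteqP; split => // y [[_ /= h1] [_ /= h2]].
  by move: h1; rewrite ltnNge h2.
Qed.

(** Convergence on each of countably many pieces suffices for uniformly bounded
    integrands, the mass being finite. *)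
Lemma cvg_Rintegral_exhaustion C (psi : nat -> S -> R) :
  (forall n, bounded_measurable C (psi n)) ->
  (forall j, \int[m]_(y in A `&` [set y | k y = j]) psi n y @[n --> \oo] --> 0) ->
  \int[m]_(y in A) psi n y @[n --> \oo] --> 0.
Proof.
move=> h pieces; have [tau tau0 tauP] := Rintegral_exhaustion.
apply/cvgr0Pnorm_lt => e e0.
have e2 : 0 < e / 2 by rewrite divr_gt0.
have tauC : C * tau J @[J --> \oo] --> 0.
  by rewrite -(mulr0 C); apply: cvgM => //; exact: cvg_cst.
have /cvgr0Pnorm_lt/(_ _ e2)[J _ /(_ J (leqnn J)) hJ] := tauC.
have partial : \int[m]_(y in A `&` [set y | (k y < J)%N]) psi n y @[n --> \oo] --> 0.
  under eq_fun do rewrite (Rintegral_partial _ (h _)).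
  elim: J {hJ} => [|J IHJ].
    by under eq_fun do rewrite big_nil; exact: cvg_cst.
  under eq_fun do rewrite big_nat_recr//=.
  have IHJ' := cvgD IHJ (pieces J); rewrite addr0 in IHJ'; exact: IHJ'.
move/cvgr0Pnorm_lt : partial => /(_ _ e2); apply: filterS => n pn.
have hn := tauP _ _ J (h n).
set x := Rintegral _ _ _ in hn *; set y := Rintegral _ _ _ in pn hn.
rewrite -(subrK y x); apply: le_lt_trans (ler_normD _ _) _.
rewrite [ltRHS](splitr e); apply: ler_ltD => //.
by apply: le_trans hn _; apply: le_trans (ler_norm _) (ltW hJ).
Qed.

End Exhaustion.

End BoundedIntegral.

(** * Couplings *)

Section Coupling.
Context d (S : measurableType d) (R : realType).
Variable m : {measure set S -> \bar R}.

(** A fundamental domain encoded by the element of G that carries it to the tile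
    of a given point; the domain itself is the fibre over 1. *)
Record fundamental_map (G : groupType) (a : G -> S -> S) (D : set S) (kappa : S -> G)
  : Prop := FundamentalMap {
  fm_measurable : level_measurable kappa;
  fm_equivariant : forall g y, D y -> kappa (a g y) = (g * kappa y)%g;
  fm_finite : (m (D `&` [set y | kappa y = 1%g]) < +oo)%E }.

(** The set D collects the points at which both tilings are exact, so that all
    identities between integrands hold pointwise on D. *)
Record coupling (G H : groupType) (a : G -> S -> S) (b : H -> S -> S)
  (D : set S) (kappa : S -> G) (chi : S -> H) : Prop := Coupling {
  cpl_acta : measure_preserving_action m a;
  cpl_actb : measure_preserving_action m b;
  cpl_comm : forall g h x, a g (b h x) = b h (a g x);
  cpl_measurable : measurable D;
  cpl_neq0 : m D <> 0%E;
  cpl_stablea : forall g y, D y -> D (a g y);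
  cpl_stableb : forall h y, D y -> D (b h y);
  cpl_kappa : fundamental_map a D kappa;
  cpl_chi : fundamental_map b D chi }.

Lemma coupling_sym G H a b D kappa chi :
  @coupling G H a b D kappa chi -> @coupling H G b a D chi kappa.
Proof. by case=> *; split. Qed.

(** On D the translates of Y form a partition, and kappa names the tile.  The
    constant value outside D keeps the level sets measurable. *)
Lemma fundamental_map_exists (G : groupType) (a : G -> S -> S) (D Y : set S) :
  measure_preserving_action m a -> measurable D -> (forall g y, D y -> D (a g y)) ->
  measurable Y -> (m Y < +oo)%E -> (forall y, D y -> exists! g, (a g @` Y) y) ->
  exists kappa, fundamental_map a D kappa.
Proof.
move=> [a1 aM amp] mD Da mY Yoo DY.
have tileE g : a g @` Y = a (g^-1)%g @^-1` Y.
  apply/seteqP; split => [y [x Yx <-]|y /= Yy]; first by rewrite /= -aM mulVg a1.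
  by exists (a (g^-1)%g y) => //; rewrite -aM mulgV a1.
have mtile g : measurable (a g @` Y).
  by rewrite tileE; have := (amp (g^-1)%g).1 measurableT _ mY; rewrite setTI.
pose kappa y := if y \in D then xget 1%g [set g | (a g @` Y) y] else 1%g.
have kappaP y : D y -> (a (kappa y) @` Y) y.
  move=> Dy; rewrite /kappa mem_set//; case: xgetP => [g -> //|none].
  by have [g [gy _]] := DY _ Dy; case: (none g).
have kappaE y g : D y -> (a g @` Y) y -> kappa y = g.
  move=> Dy gy; have [g' [_ u]] := DY _ Dy.
  by rewrite -(u _ gy) -(u _ (kappaP _ Dy)).
exists kappa; split.
- move=> g.
  rewrite (_ : [set _ | _] = (D `&` (a g @` Y)) `|` (~` D `&` [set _ | g = 1%g])).
    apply: measurableU; first exact: measurableI.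
    apply: measurableI; first exact: measurableC.
    have [->|g1] := eqVneq g 1%g.
      by rewrite (_ : [set _ | _] = setT)//; apply/seteqP; split.
    by rewrite (_ : [set _ | _] = set0)//; apply/seteqP; split => // y /= /eqP; rewrite (negbTE g1).
  apply/seteqP; split => [y /= <-|y /= [[Dy gy]|[nDy ->]]].
  + have [Dy|nDy] := pselect (D y); [left|right]; split => //.
      exact: kappaP.
    by rewrite /kappa memNset.
  + exact: kappaE.
  + by rewrite /kappa memNset.
- move=> g y Dy; apply: kappaE; first exact: Da.
  have [x Yx xy] := kappaP _ Dy; exists x => //.
  by rewrite aM xy.
- apply: le_lt_trans Yoo; apply: le_measure; rewrite ?inE//.
    rewrite (_ : _ `&` _ = D `&` (a 1%g @` Y)); first exact: measurableI.
    apply/seteqP; split => y [Dy /= k1]; split => //=; last exact: kappaE.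
    by have := kappaP _ Dy; rewrite k1.
  by move=> y [Dy /= k1]; have := kappaP _ Dy; rewrite k1 => -[x Yx <-]; rewrite a1.
Qed.

End Coupling.

(** The exceptional null set N of the two fundamental domains is enlarged to the
    union B of its translates under both groups, which is still null because the
    groups are countable; D is the complement of B. *)
Lemma measure_equivalent_coupling (R : realType) (G H : groupType) :
  countable [set: G] -> countable [set: H] -> measure_equivalent R G H ->
  exists (d : measure_display) (S : measurableType d) (m : {measure set S -> \bar R})
    (a : G -> S -> S) (b : H -> S -> S) (D : set S) (kappa : S -> G) (chi : S -> H),
    coupling m a b D kappa chi.
Proof.
move=> cG cH [d [S [m [a [b [[_ _ S0] ama amb ab [[Y [mY Yae] Yoo] [Z [mZ Zae] Zoo]]]]]]]].
have [A1 [mA1 A10 YA1]] := Yae; have [A2 [mA2 A20 ZA2]] := Zae.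
have [code [e codeK]] := countable_enum (1%g, 1%g) (countable_pair cG cH).
pose N := A1 `|` A2.
have mN : measurable N by exact: measurableU.
have N0 : m N = 0%E.
  apply/eqP; rewrite eq_le measure_ge0 andbT; apply: le_trans (measureU2 _ _ _) _ => //.
  by rewrite [X in (X + _)%E](_ : _ = 0%E)// [X in (_ + X)%E](_ : _ = 0%E)// adde0.
case: (ama) => a1 aM amp; case: (amb) => b1 bM bmp.
pose T n y := a (e n).1 (b (e n).2 y).
have mT n A : measurable A -> measurable (T n @^-1` A) /\ m (T n @^-1` A) = m A.
  move=> mA.
  have mA' : measurable (a (e n).1 @^-1` A).
    by have := (amp (e n).1).1 measurableT _ mA; rewrite setTI.
  split; first by have := (bmp (e n).2).1 measurableT _ mA'; rewrite setTI.
  rewrite (_ : _ @^-1` _ = b (e n).2 @^-1` (a (e n).1 @^-1` A))//.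
  by rewrite (bmp _).2// (amp _).2.
pose B := \bigcup_n (T n @^-1` N).
have mB : measurable B by apply: bigcupT_measurable => n; exact: (mT n N mN).1.
have B0 : m B = 0%E.
  apply/eqP; rewrite eq_le measure_ge0 andbT.
  have : m.-negligible B.
    apply: negligible_bigcup => n; exists (T n @^-1` N); split => //.
      exact: (mT n N mN).1.
    by rewrite (mT n N mN).2.
  by case=> B' [mB' <- BB']; apply: le_measure; rewrite ?inE.
have DP y : (~` B) y <-> forall g h, ~ N (a g (b h y)).
  split=> [nBy g h Ny|h [n _ Ny]]; last exact: h Ny.
  by apply: nBy; exists (code (g, h)) => //=; rewrite /T codeK.
have Da g y : (~` B) y -> (~` B) (a g y).
  by move=> /DP Dy; apply/DP => g' h'; rewrite -ab -aM; exact: Dy.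
have Db h y : (~` B) y -> (~` B) (b h y).
  by move=> /DP Dy; apply/DP => g' h'; rewrite -bM; exact: Dy.
have mD : measurable (~` B) by exact: measurableC.
have DY y : (~` B) y -> exists! g, (a g @` Y) y.
  move=> /DP/(_ 1%g 1%g); rewrite a1 b1 => nN; apply: contrapT => h; apply: nN.
  by left; exact: YA1.
have DZ y : (~` B) y -> exists! h, (b h @` Z) y.
  move=> /DP/(_ 1%g 1%g); rewrite a1 b1 => nN; apply: contrapT => h; apply: nN.
  by right; exact: ZA2.
have [kappa kappaP] := fundamental_map_exists ama mD Da mY Yoo DY.
have [chi chiP] := fundamental_map_exists amb mD Db mZ Zoo DZ.
exists d, S, m, a, b, (~` B), kappa, chi; split => //.
move=> D0; apply: S0; apply/eqP; rewrite eq_le measure_ge0 andbT -(setUv B).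
apply: le_trans (measureU2 _ _ _) _ => //.
by rewrite [X in (X + _)%E]B0 [X in (_ + X)%E]D0 adde0.
Qed.

Section Unfolding.
Context d (S : measurableType d) (R : realType).
Variable m : {measure set S -> \bar R}.
Variables (G H : groupType) (a : G -> S -> S) (b : H -> S -> S).
Variables (D : set S) (kappa : S -> G) (chi : S -> H).
Hypothesis cG : countable [set: G].
Hypothesis cpl : coupling m a b D kappa chi.

Local Notation Y := (D `&` [set y | kappa y = 1%g]).

Lemma finite_measurable_domain : finite_measurable m Y.
Proof.
case: cpl => _ _ _ mD _ _ _ [mk _ Yoo] _; split => //.
by apply: measurableI => //; exact: mk.
Qed.

(** D is a countable union of translates of Y and is not null. *)
Lemma domain_measure_gt0 : 0 < fine (m Y).
Proof.
have [mY Yoo] := finite_measurable_domain.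
rewrite lt_neqAle fine_ge0// andbT; apply/eqP => Y0.
case: cpl => [[a1 aM amp] _ _ mD D0 Da _ [_ ke _] _]; apply: D0.
have {}Y0 : m Y = 0%E by rewrite -[LHS]fineK -?Y0// ge0_fin_numE.
have [code [e codeK]] := countable_enum 1%g cG.
have mT n : measurable (a (e n) @^-1` Y).
  by have := (amp (e n)).1 measurableT _ mY; rewrite setTI.
have : m.-negligible (\bigcup_n (a (e n) @^-1` Y)).
  apply: negligible_bigcup => n; exists (a (e n) @^-1` Y); split => //.
  by rewrite (amp _).2.
case=> B' [mB' B'0 BB']; apply/eqP; rewrite eq_le measure_ge0 andbT -B'0.
apply: le_measure; rewrite ?inE// => y Dy; apply: BB'.
exists (code (kappa y)^-1%g) => //=; rewrite codeK; split; first exact: Da.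
by rewrite /= ke// mulVg.
Qed.

(** The set b h (Y) is another fundamental domain for G.  The points y of Y that
    b h sends to the tile of g correspond, under y |-> g^-1 h y, to the points of
    Y that b h^-1 sends to the tile of g^-1; summing over g gives the claim. *)
Lemma Rintegral_domain_invariant C phi h : bounded_measurable C phi ->
  (forall g y, D y -> phi (a g y) = phi y) ->
  \int[m]_(y in Y) phi (b h y) = \int[m]_(y in Y) phi y.
Proof.
move=> bphi phia; have fY := finite_measurable_domain.
have [code [e codeK]] := countable_enum 1%g cG.
case: (cpl) => [[a1 aM amp] [b1 bM bmp] ab mD _ Da Db [mk ke _] _].
pose k1 y := code (kappa (b h y)).
pose k2 y := code (kappa (b (h^-1)%g y))^-1%g.
have mk1 : level_measurable k1.
  move=> q; apply: (level_measurable_preimage (fun g => code g = q) cG).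
  by apply: level_measurable_comp => //; case: (bmp h).
have mk2 : level_measurable k2.
  move=> q; apply: (level_measurable_preimage (fun g => code (g^-1)%g = q) cG).
  by apply: level_measurable_comp => //; case: (bmp (h^-1)%g).
have bphi' : bounded_measurable C (fun y => phi (b h y)).
  by apply: bounded_measurable_comp => //; case: (bmp h).
have pieceE j : \int[m]_(y in Y `&` [set y | k1 y = j]) phi (b h y) =
    \int[m]_(y in Y `&` [set y | k2 y = j]) phi y.
  have [[g gj]|nj] := pselect (exists g, code g = j); last first.
    rewrite (_ : _ `&` _ = set0) ?[in RHS](_ : _ `&` [set y | k2 y = j] = set0).
    - by rewrite !Rintegral_set0.
    - by apply/seteqP; split=> // y [_ /= k2y]; apply: nj; eexists; exact: k2y.
    - by apply/seteqP; split=> // y [_ /= k1y]; apply: nj; eexists; exact: k1y.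
  pose T y := a (g^-1)%g (b h y).
  have mpT : measure_preserving m T.
    have [ma pa] := amp (g^-1)%g; have [mb pb] := bmp h; split.
      exact: measurableT_comp.
    move=> A mA; rewrite (_ : T @^-1` A = b h @^-1` (a (g^-1)%g @^-1` A))//.
    by rewrite pb ?pa//; have := ma measurableT _ mA; rewrite setTI.
  have fZ : finite_measurable m (Y `&` [set y | k2 y = j]).
    exact: finite_measurableI.
  rewrite (Rintegral_measure_preserving mpT fZ bphi).
  rewrite (_ : T @^-1` _ = Y `&` [set y | k1 y = j]); last first.
    apply/seteqP; split => y.
      move=> [[DTy /= kT] /= k2y].
      have yE : y = b (h^-1)%g (a g (T y)).
        by rewrite /T -aM mulgV a1 -bM mulVg b1.
      have Dy : D y by rewrite yE; apply: Db; exact: Da.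
      move: k2y; rewrite /k2 /T -ab -bM mulVg b1 ke// invgM invgK -gj => /(can_inj codeK).
      move/(congr1 (fun x => x * g^-1)%g); rewrite mulgK mulgV => /eqP; rewrite invg_eq1 => /eqP ky.
      split=> //=.
      by move: kT; rewrite /T ke; [move/(congr1 (fun x => g * x)%g); rewrite mulVKg mulg1 /k1 => ->|exact: Db].
    move=> [[Dy /= ky] /= k1y]; split; first split.
    - by apply: Da; exact: Db.
    - move: k1y; rewrite /k1 -gj => /(can_inj codeK) ky'.
      by rewrite /= /T ke ?ky' ?mulVg//; exact: Db.
    - by rewrite /= /k2 /T -ab -bM mulVg b1 ke// ky mulg1 invgK.
  apply: eq_Rintegral => y; rewrite inE => -[[Dy _] _].
  by rewrite /T phia//; exact: Db.
have [t1 t10 t1P] := Rintegral_exhaustion fY mk1.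
have [t2 t20 t2P] := Rintegral_exhaustion fY mk2.
apply/eqP; rewrite -subr_eq0 -normr_le0; apply/ler_addgt0Pr => eps eps0.
have tC : C * t1 J + C * t2 J @[J --> \oo] --> 0.
  rewrite -(addr0 0); apply: cvgD; rewrite -(mulr0 C).
    by apply: cvgM => //; exact: cvg_cst.
  by apply: cvgM => //; exact: cvg_cst.
have /cvgr0Pnorm_lt/(_ _ eps0)[J _ /(_ J (leqnn J)) hJ] := tC.
have h1 := t1P _ _ J bphi'; have h2 := t2P _ _ J bphi.
move: h1 h2; rewrite !(Rintegral_partial fY _ _ bphi)// !(Rintegral_partial fY _ _ bphi')//.
under eq_bigr do rewrite pieceE.
set s := \sum_(_ <= _ < _) _; set u := Rintegral _ _ _; set v := Rintegral _ _ _.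
move=> h1 h2; rewrite add0r.
rewrite (_ : u - v = (u - s) - (v - s)); last by ring.
apply: le_trans (ler_normB _ _) _; apply: le_trans (lerD h1 h2) _.
exact: le_trans (ler_norm _) (ltW hJ).
Qed.

End Unfolding.

Section Tiles.
Context d (S : measurableType d) (R : realType).
Variable m : {measure set S -> \bar R}.
Variables (G H : groupType) (a : G -> S -> S) (b : H -> S -> S).
Variables (D : set S) (kappa : S -> G) (chi : S -> H).
Hypothesis cpl : coupling m a b D kappa chi.

Local Notation Y := (D `&` [set y | kappa y = 1%g]).

Lemma Rintegral_tile C phi g : bounded_measurable C phi ->
  finite_measurable m (D `&` [set y | kappa y = g]) /\
  \int[m]_(y in D `&` [set y | kappa y = g]) phi y = \int[m]_(y in Y) phi (a g y).
Proof.
move=> bphi; have [mY Yoo] := finite_measurable_domain cpl.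
case: (cpl) => [[a1 aM amp] _ _ mD _ Da _ [mk ke _] _].
have preE : a g @^-1` (D `&` [set y | kappa y = g]) = Y.
  apply/seteqP; split => [y [Dgy /= kgy]|y [Dy /= ky]]; split => /=.
  - by rewrite -(a1 y) -(mulVg g) aM; exact: Da.
  - by rewrite -(a1 y) -(mulVg g) aM ke// kgy.
  - exact: Da.
  - by rewrite ke// ky mulg1.
have fT : finite_measurable m (D `&` [set y | kappa y = g]).
  have mT : measurable (D `&` [set y | kappa y = g]) by apply: measurableI => //; exact: mk.
  by split => //; rewrite -((amp g).2 _ mT) preE.
split=> //.
by rewrite (Rintegral_measure_preserving (amp g) fT bphi) preE.
Qed.

Lemma Rintegral_tiles C phi (r : seq G) : bounded_measurable C phi -> uniq r ->
  finite_measurable m (D `&` [set y | kappa y \in r]) /\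
  \int[m]_(y in D `&` [set y | kappa y \in r]) phi y =
    \sum_(g <- r) \int[m]_(y in Y) phi (a g y).
Proof.
move=> bphi; elim: r => [|g r IHr] /=.
  move=> _; rewrite (_ : _ `&` _ = set0); last by apply/seteqP; split => // y [].
  by rewrite big_nil Rintegral_set0; split => //; split; rewrite ?measure0.
move=> /andP[gr /IHr[fr rE]]; have [fg gE] := Rintegral_tile g bphi.
rewrite (_ : D `&` _ = (D `&` [set y | kappa y = g]) `|` (D `&` [set y | kappa y \in r])).
  split.
    have [mg goo] := fg; have [mr roo] := fr; split; first exact: measurableU.
    by apply: le_lt_trans (measureU2 _ _ _) _ => //; exact: lte_add_pinfty.
  rewrite (Rintegral_boundedU fg fr _ bphi) ?big_cons ?gE ?rE//.
  by apply/seteqP; split => // y [[_ /= ky] [_ /=]]; rewrite ky (negbTE gr).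
rewrite -setIUr; congr (_ `&` _); apply/seteqP; split => y /=.
  by rewrite in_cons => /predU1P[]; [left|right].
by rewrite in_cons => -[->|->]; rewrite ?eqxx ?orbT.
Qed.

End Tiles.

Section UnfoldingBound.
Context d (S : measurableType d) (R : realType).
Variable m : {measure set S -> \bar R}.
Variables (G H : groupType) (a : G -> S -> S) (b : H -> S -> S).
Variables (D : set S) (kappa : S -> G) (chi : S -> H).
Hypothesis cH : countable [set: H].
Hypothesis cpl : coupling m a b D kappa chi.

Local Notation Y := (D `&` [set y | kappa y = 1%g]).
Local Notation X := (D `&` [set y | chi y = 1%g]).

(** The left-hand side is the integral over the tiles of r.  Cut these
    tiles by the translates of X instead: each piece moves into X, where the
    summation over H is bounded by K. *)
Lemma sum_Rintegral_unfold C K phi (r : seq G) : bounded_measurable C phi ->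
  (forall y, 0 <= phi y) ->
  (forall y, D y -> forall r' : seq H, uniq r' -> \sum_(h <- r') phi (b h y) <= K) ->
  uniq r -> \sum_(g <- r) \int[m]_(y in Y) phi (a g y) <= K * fine (m X).
Proof.
move=> bphi phi0 hK ur; have [fB <-] := Rintegral_tiles cpl bphi ur.
set B := D `&` _ in fB *.
have [code [e codeK]] := countable_enum 1%g cH.
pose k y := code (chi y).
have fX := finite_measurable_domain (coupling_sym cpl).
case: (cpl) => [_ [b1 bM bmp] _ mD _ _ _ _ [mc ce _]].
have mk : level_measurable k.
  by move=> q; exact: (level_measurable_preimage (fun h => code h = q) cH).
have [tau tau0 tauP] := Rintegral_exhaustion fB mk.
have bb h : bounded_measurable C (fun y => phi (b h y)).
  by apply: bounded_measurable_comp => //; case: (bmp h).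
have partial J : \int[m]_(y in B `&` [set y | (k y < J)%N]) phi y <= K * fine (m X).
  rewrite (Rintegral_partial fB mk _ bphi).
  pose P j := code (e j) == j.
  apply: (@le_trans _ _ (\sum_(0 <= j < J | P j) \int[m]_(x in X) phi (b (e j) x))).
    rewrite [leRHS]big_mkcond/=; apply: ler_sum => j _; rewrite /P; case: eqP => ej.
      have [fT <-] := Rintegral_tile (coupling_sym cpl) (e j) bphi.
      apply: le_Rintegral_set bphi phi0 => //.
        by apply: measurableI; [case: fB|exact: mk].
      move=> y [[Dy _] /= kj]; split => //=.
      by rewrite -kj /k codeK.
    rewrite (_ : _ `&` _ = set0) ?Rintegral_set0//.
    by apply/seteqP; split => // y [_ /= kj]; apply: ej; rewrite -kj /k codeK.
  rewrite -big_filter -(big_map e xpredT (fun h => \int[m]_(x in X) phi (b h x))).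
  set r' := map _ _.
  have ur' : uniq r'.
    rewrite map_inj_in_uniq ?filter_uniq ?iota_uniq// => i j.
    rewrite !mem_filter => /andP[/eqP ei _] /andP[/eqP ej _] eij.
    by rewrite -ei -ej eij.
  rewrite -(Rintegral_bounded_sum fX r' bb) -Rintegral_cst; last by case: fX.
  have bs := bounded_measurable_sum r' bb.
  apply: (le_Rintegral_bounded fX bs (bounded_measurable_cst _ K)).
  by move=> y [Dy _]; exact: hK.
apply/ler_addgt0Pr => eps eps0.
have tauC : C * tau J @[J --> \oo] --> 0.
  by rewrite -(mulr0 C); apply: cvgM => //; exact: cvg_cst.
have /cvgr0Pnorm_lt/(_ _ eps0)[J _ /(_ J (leqnn J)) hJ] := tauC.
have := tauP _ _ J bphi; have := partial J.
have := ler_norm (C * tau J); move: hJ.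
set u := Rintegral _ _ _; set v := Rintegral _ _ _; set t := `|C * tau J|.
have := ler_norm (v - u); rewrite distrC.
have := ler_norm (u - v).
lra.
Qed.

End UnfoldingBound.

(** * From cocycles on H to cocycles on G and back *)

Section Transfer.
Context d (S : measurableType d) (R : realType).
Variable m : {measure set S -> \bar R}.
Variables (G H : groupType) (a : G -> S -> S) (b : H -> S -> S).
Variables (D : set S) (kappa : S -> G) (chi : S -> H).
Hypotheses (cG : countable [set: G]) (cH : countable [set: H]).
Hypothesis cpl : coupling m a b D kappa chi.

Local Notation Y := (D `&` [set y | kappa y = 1%g]).
Local Notation X := (D `&` [set y | chi y = 1%g]).

Variables (c : H -> H -> H -> H -> R) (C : R).
Hypotheses (cinv : equivariant2 c) (cC : forall x y z, l2_le C (c x y z)).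
Hypothesis cc : cocycle2 c.

Let fY := finite_measurable_domain cpl.

Let mchi g : level_measurable (fun y => chi (a g y)).
Proof.
case: cpl => [[_ _ amp] _ _ _ _ _ _ _ [mc _ _]].
by apply: level_measurable_comp => //; case: (amp g).
Qed.

(** The value at 1 suffices: by equivariance the coordinate at l is the value at
    1 of the same function at the point b l^-1 y. *)
Definition induced (g0 g1 g2 : G) y : R :=
  c (chi (a (g0^-1)%g y)) (chi (a (g1^-1)%g y)) (chi (a (g2^-1)%g y)) 1%g.

Lemma level3_bounded_measurable (k0 k1 k2 : S -> H) l :
  level_measurable k0 -> level_measurable k1 -> level_measurable k2 ->
  bounded_measurable (C + 1) (fun y => c (k0 y) (k1 y) (k2 y) l).
Proof.
move=> m0 m1 m2; split; last by move=> y; exact: l2_le_norm.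
have mk := level_measurable_pair (level_measurable_pair m0 m1) m2.
have cH3 := countable_pair (countable_pair cH cH) cH.
exact: (level_measurable_fun (fun p => c p.1.1 p.1.2 p.2 l) cH3 mk).
Qed.

Lemma induced_bounded_measurable g0 g1 g2 :
  bounded_measurable (C + 1) (induced g0 g1 g2).
Proof. exact: level3_bounded_measurable. Qed.

Definition induced_cochain A (g0 g1 g2 g : G) : R :=
  \int[m]_(y in A) induced g0 g1 g2 (a g y).

Let induced_act g0 g1 g2 g : bounded_measurable (C + 1) (fun y => induced g0 g1 g2 (a g y)).
Proof.
apply: bounded_measurable_comp (induced_bounded_measurable g0 g1 g2).
by case: cpl => [[_ _ amp] *]; case: (amp g).
Qed.

Lemma induced_cochain_equivariant A : equivariant2 (induced_cochain A).
Proof.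
move=> g x y z t; apply: eq_Rintegral => s _; rewrite /induced.
have [[_ aM _] _ _ _ _ _ _ _ _] := cpl.
by rewrite -!aM !invgM -!mulgA !mulKg.
Qed.

Lemma induced_cochain_cocycle A : finite_measurable m A -> cocycle2 (induced_cochain A).
Proof.
move=> fA x y z u t; rewrite /induced_cochain.
rewrite -(Rintegral_boundedB fA (induced_act _ _ _ _) (induced_act _ _ _ _)).
rewrite -(Rintegral_boundedD fA (bounded_measurableB (induced_act _ _ _ _)
   (induced_act _ _ _ _)) (induced_act _ _ _ _)).
rewrite -(Rintegral_boundedB fA (bounded_measurableD (bounded_measurableB
   (induced_act _ _ _ _) (induced_act _ _ _ _)) (induced_act _ _ _ _)) (induced_act _ _ _ _)).
rewrite (_ : Rintegral _ _ _ = Rintegral m A (fun=> 0)).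
  by rewrite Rintegral_cst ?mul0r//; case: fA.
by apply: eq_Rintegral => s _; exact: cc.
Qed.

(** After Cauchy-Schwarz on A, the sum over G unfolds to X, where the sum over H
    is the l^2 norm of a value of c. *)
Lemma induced_cochain_l2 A g0 g1 g2 : measurable A -> A `<=` Y ->
  l2_le (fine (m A) * (C * fine (m X))) (induced_cochain A g0 g1 g2).
Proof.
move=> mA AY r ur; have fA := finite_measurableS mA AY fY.
apply: (@le_trans _ _ (\sum_(g <- r) fine (m A) *
   \int[m]_(y in A) (induced g0 g1 g2 (a g y) ^+ 2))).
  by apply: ler_sum => g _; exact: Rintegral_cauchy_schwarz (induced_act _ _ _ _).
rewrite -mulr_sumr ler_wpM2l ?fine_ge0//.
apply: (@le_trans _ _ (\sum_(g <- r)
   \int[m]_(y in Y) (induced g0 g1 g2 (a g y) ^+ 2))).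
  apply: ler_sum => g _; apply: le_Rintegral_set => //.
    exact: bounded_measurable_sqr (induced_act _ _ _ _).
  by move=> y; rewrite sqr_ge0.
apply: (sum_Rintegral_unfold cH cpl
   (bounded_measurable_sqr (induced_bounded_measurable g0 g1 g2))) => // [y|y Dy r' ur'].
  by rewrite sqr_ge0.
case: (cpl) => [_ _ ab _ _ Da _ _ [_ ce _]].
under eq_bigr => h _.
  rewrite /induced !ab !ce; try exact: Da.
  rewrite -(cinv h^-1%g) !mulKg mulg1.
over.
have := @l2_le_comp R H C _ (fun h => h^-1)%g invg_inj (cC (chi (a g0^-1%g y))
  (chi (a g1^-1%g y)) (chi (a g2^-1%g y))).
exact.
Qed.

(** kappa (l^-1 y) is invariant under the diagonal action of H and
    equivariant under G; translating it by s and applying chi gives an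
    element of H that is equivariant in (l, y) under H and invariant in y under G. *)
Definition straighten (l : H) (s : G) y : H :=
  chi (a ((kappa (b l^-1%g y) * s)^-1)%g y).

Lemma straighten_level_measurable l s : level_measurable (straighten l s).
Proof.
case: (cpl) => [_ [_ _ bmp] _ _ _ _ _ [mk _ _] _].
apply: (level_measurable_bind (k := fun y => kappa (b l^-1%g y))
  (l := fun p y => chi (a ((p * s)^-1)%g y))) => //.
by apply: level_measurable_comp => //; case: (bmp l^-1%g).
Qed.

Lemma straighten_invariant l s g y : D y -> straighten l s (a g y) = straighten l s y.
Proof.
case: (cpl) => [[_ aM _] _ ab _ _ _ Db [_ ke _] _] Dy.
by rewrite /straighten -ab ke; [rewrite !invgM -aM -!mulgA mulVg mulg1|exact: Db].
Qed.

Lemma straighten_equivariant h l s y : D y ->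
  straighten (h * l)%g s y = (h * straighten l s (b h^-1%g y))%g.
Proof.
case: (cpl) => [_ [b1 bM _] ab _ _ Da Db _ [_ ce _]] Dy.
rewrite /straighten ab ce; last exact: Da.
by rewrite mulVKg -bM -invgM.
Qed.

Section Average.
Variable w : seq (R * G).
Hypothesis wp : is_prob w.

(** The prism operator between the identity of H and straighten. *)
Definition homotopy_integrand l0 l1 l y : R :=
  mean w (fun s0 => mean w (fun s1 =>
    c l0 l1 (straighten l1 s1 y) l -
    c l0 (straighten l0 s0 y) (straighten l1 s1 y) l)).

Definition straightened_integrand l0 l1 l2 l y : R :=
  mean w (fun s0 => mean w (fun s1 => mean w (fun s2 =>
    c (straighten l0 s0 y) (straighten l1 s1 y) (straighten l2 s2 y) l))).

(** The prism identity follows from the cocycle relation on the three simplices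
    (l0, l1, l2, z2), (l0, l1, z1, z2) and (l0, z0, z1, z2). *)
Lemma homotopy_formula l0 l1 l2 l y :
  c l0 l1 l2 l - coboundary1 (fun x z t => homotopy_integrand x z t y) l0 l1 l2 l =
  straightened_integrand l0 l1 l2 l y.
Proof.
rewrite /coboundary1 /homotopy_integrand /straightened_integrand.
rewrite -[X in X - _](mean_cst _ wp) -[X in _ - (X - _ + _)](mean_cst _ wp).
rewrite -meanB -meanD -meanB; apply: eq_mean => s0.
rewrite -[X in X - _](mean_cst _ wp) -[X in _ - (_ - X + _)](mean_cst _ wp).
rewrite -meanB -meanD -meanB; apply: eq_mean => s1.
rewrite -[X in X - _](mean_cst _ wp) -[X in _ - (_ - _ + X)](mean_cst _ wp).
rewrite -meanB -meanD -meanB; apply: eq_mean => s2.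
set z0 := straighten l0 s0 y; set z1 := straighten l1 s1 y; set z2 := straighten l2 s2 y.
have h1 := cc l0 l1 l2 z2 l; have h2 := cc l0 z0 z1 z2 l; have h3 := cc l0 l1 z1 z2 l.
lra.
Qed.

Lemma homotopy_integrand_bounded l0 l1 l :
  bounded_measurable (C + 1 + (C + 1)) (homotopy_integrand l0 l1 l).
Proof.
apply: bounded_measurable_mean => // s0; apply: bounded_measurable_mean => // s1.
have mz s t := straighten_level_measurable s t.
have mcst (p : H) : level_measurable (fun _ : S => p).
  move=> q; have [->|pq] := eqVneq p q.
    by rewrite (_ : [set _ | _] = setT)//; apply/seteqP; split.
  by rewrite (_ : [set _ | _] = set0)//; apply/seteqP; split => // y /= /eqP; rewrite (negbTE pq).
by apply: bounded_measurableB; apply: level3_bounded_measurable.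
Qed.

Lemma straightened_integrand_bounded l0 l1 l2 l :
  bounded_measurable (C + 1) (straightened_integrand l0 l1 l2 l).
Proof.
do 3 (apply: bounded_measurable_mean => // ?).
by apply: level3_bounded_measurable; exact: straighten_level_measurable.
Qed.

Lemma homotopy_integrand_l2 l0 l1 y :
  l2_le (4 * C) (fun l => homotopy_integrand l0 l1 l y).
Proof.
do 2 (apply: mean_l2_le => // ?).
apply: l2_leW (l2_leB (cC _ _ _) (cC _ _ _)); lra.
Qed.

Definition homotopy l0 l1 l : R :=
  (fine (m Y))^-1 * \int[m]_(y in Y) homotopy_integrand l0 l1 l y.

Definition straightened l0 l1 l2 l : R :=
  (fine (m Y))^-1 * \int[m]_(y in Y) straightened_integrand l0 l1 l2 l y.

Let Y0 : fine (m Y) != 0.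
Proof. by rewrite gt_eqF//; exact: domain_measure_gt0 cG cpl. Qed.

Lemma homotopy_coboundary l0 l1 l2 l :
  c l0 l1 l2 l - coboundary1 homotopy l0 l1 l2 l = straightened l0 l1 l2 l.
Proof.
have hb x z := homotopy_integrand_bounded x z l.
rewrite /straightened (_ : Rintegral _ _ _ = \int[m]_(y in Y)
    (c l0 l1 l2 l - (homotopy_integrand l1 l2 l y - homotopy_integrand l0 l2 l y +
     homotopy_integrand l0 l1 l y))); last first.
  by apply: eq_Rintegral => y _; rewrite -homotopy_formula.
rewrite (Rintegral_boundedB fY (bounded_measurable_cst _ _)
  (bounded_measurableD (bounded_measurableB (hb _ _) (hb _ _)) (hb _ _))).
rewrite (Rintegral_boundedD fY (bounded_measurableB (hb _ _) (hb _ _)) (hb _ _)).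
rewrite (Rintegral_boundedB fY (hb _ _) (hb _ _)) Rintegral_cst; last by case: fY.
rewrite /coboundary1 /homotopy mulrBr [X in _ = X - _]mulrCA mulVf// mulr1.
by rewrite mulrDr mulrBr.
Qed.

(** Translating all arguments by h translates the integrand by b h; the integral
    does not see it, since the integrand is G-invariant. *)
Lemma homotopy_equivariant : equivariant1 homotopy.
Proof.
move=> h x z l; rewrite /homotopy; congr (_ * _).
rewrite -(Rintegral_domain_invariant cG cpl h^-1%g (homotopy_integrand_bounded x z l)).
  apply: eq_Rintegral => y; rewrite inE => -[Dy _].
  do 2 (apply: eq_mean => ?); rewrite !straighten_equivariant//.
  by rewrite !cinv.
move=> g y Dy; do 2 (apply: eq_mean => ?).
by rewrite !straighten_invariant.
Qed.

Lemma homotopy_l2 x z : l2_le (4 * C) (homotopy x z).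
Proof.
move=> r ur; have hb l := homotopy_integrand_bounded x z l.
have Yp : 0 < fine (m Y) by exact: domain_measure_gt0 cG cpl.
under eq_bigr do rewrite exprMn.
rewrite -mulr_sumr exprVn mulrC ler_pdivrMr ?exprn_gt0//.
apply: le_trans (Rintegral_square_sum fY (D := 4 * C) hb _) _.
  by move=> y _; exact: homotopy_integrand_l2.
by rewrite expr2 mulrCA mulrA.
Qed.

(** Where kappa (p_i^-1 y) has the constant value g_i, straighten only involves the
    points g_i s_i of G.  The substitution y = l g y' moves Z to a set on
    which c at the coordinate l becomes an induced function at g y'. *)
Lemma straightened_integral_piece Z p0 p1 p2 g0 g1 g2 l g :
  measurable Z -> Z `<=` Y ->
  (forall y, Z y -> [/\ kappa (b p0^-1%g y) = g0, kappa (b p1^-1%g y) = g1 &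
     kappa (b p2^-1%g y) = g2]) ->
  \int[m]_(y in Z) straightened_integrand p0 p1 p2 l y =
  average2 w (induced_cochain ((fun y => b l (a g y)) @^-1` Z)) g0 g1 g2 g.
Proof.
move=> mZ ZY Zk; pose T y := b l (a g y).
case: (cpl) => [[a1 aM amp] [b1 bM bmp] ab mD _ Da Db [_ ke _] [_ ce _]].
have mpT : measure_preserving m T.
  have [ma pa] := amp g; have [mb pb] := bmp l; split.
    exact: measurableT_comp.
  move=> A mA; rewrite (_ : T @^-1` A = a g @^-1` (b l @^-1` A))//.
  by rewrite pa ?pb//; have := mb measurableT _ mA; rewrite setTI.
have fZ := finite_measurableS mZ ZY fY.
have fA : finite_measurable m (T @^-1` Z).
  split; first by have := mpT.1 measurableT _ mZ; rewrite setTI.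
  by rewrite mpT.2//; case: fZ.
rewrite (Rintegral_measure_preserving mpT fZ (straightened_integrand_bounded _ _ _ _)).
have -> : average2 w (induced_cochain (T @^-1` Z)) g0 g1 g2 g =
    \int[m]_(y in T @^-1` Z) mean w (fun s0 => mean w (fun s1 => mean w (fun s2 =>
      induced (g0 * s0)%g (g1 * s1)%g (g2 * s2)%g (a g y)))).
  have bi s0 s1 s2 := induced_act (g0 * s0)%g (g1 * s1)%g (g2 * s2)%g g.
  have bi1 s0 s1 := bounded_measurable_mean wp (bi s0 s1).
  have bi2 s0 := bounded_measurable_mean wp (bi1 s0).
  rewrite (Rintegral_mean fA w bi2); apply: eq_mean => s0.
  rewrite (Rintegral_mean fA w (bi1 s0)); apply: eq_mean => s1.
  by rewrite (Rintegral_mean fA w (bi s0 s1)).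
apply: eq_Rintegral => y; rewrite inE => Zy; have [k0 k1 k2] := Zk _ Zy.
have Dy : D y.
  have [DT _] := ZY _ Zy.
  rewrite -[y]a1 -(mulVg g) aM; apply: Da.
  by rewrite -[a g y]b1 -(mulVg l) bM; exact: Db.
do 3 (apply: eq_mean => ?).
have Dgy s : D (a s (a g y)) by do 2 apply: (Da).
rewrite /induced /straighten k0 k1 k2 /T !ab !ce//.
by rewrite -[in LHS](cinv l^-1%g) !mulKg mulVg.
Qed.

End Average.

(** Y is cut by the values of kappa at l0^-1 y, l1^-1 y, l2^-1 y and l^-1 y.  The
    last one ensures that the moved piece A lies in Y, so that the cochain
    induced from A is a bounded cocycle on G. *)
Lemma straightened_cvg (w : nat -> seq (R * G)) : (forall n, is_prob (w n)) ->
  (forall (u : G -> G -> G -> G -> R) K, equivariant2 u ->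
    (forall x y z, l2_le K (u x y z)) -> cocycle2 u -> forall x y z t,
    average2 (w n) u x y z t - average2 (w n) u 1 1 1 t @[n --> \oo] --> (0 : R)) ->
  forall l0 l1 l2 l,
  straightened (w n) l0 l1 l2 l - straightened (w n) 1 1 1 l @[n --> \oo] --> (0 : R).
Proof.
move=> wp wP l0 l1 l2 l.
case: (cpl) => [[a1 aM amp] [b1 bM bmp] ab mD _ Da Db [mk ke _] [_ ce _]].
have hb n p0 p1 p2 := straightened_integrand_bounded (wp n) p0 p1 p2 l.
pose psi n y := straightened_integrand (w n) l0 l1 l2 l y -
  straightened_integrand (w n) 1 1 1 l y.
have bpsi n : bounded_measurable (C + 1 + (C + 1)) (psi n).
  exact: bounded_measurableB.
suff psi0 : \int[m]_(y in Y) psi n y @[n --> \oo] --> 0.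
  under eq_fun do rewrite /straightened -mulrBr -(Rintegral_boundedB fY (hb _ _ _ _) (hb _ _ _ _)).
  by rewrite -(mulr0 (fine (m Y))^-1); apply: cvgM => //; exact: cvg_cst.
pose K := (G * G * G * G)%type.
pose q y : K := (kappa (b l0^-1%g y), kappa (b l1^-1%g y),
                 kappa (b l2^-1%g y), kappa (b l^-1%g y)).
have cK : countable [set: K] by do 3 apply: countable_pair => //.
have mq : level_measurable q.
  have mkb p : level_measurable (fun y => kappa (b p y)).
    by apply: level_measurable_comp => //; case: (bmp p).
  by do 3 apply: level_measurable_pair => //.
have [code [e codeK]] := countable_enum (1, 1, 1, 1)%g cK.
have mcode : level_measurable (fun y => code (q y)).
  by move=> j; exact: (level_measurable_preimage (fun p => code p = j) cK mq).
apply: (cvg_Rintegral_exhaustion fY mcode bpsi) => j.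
set Z := Y `&` _.
have [[p pj]|nj] := pselect (exists p, code p = j); last first.
  rewrite (_ : Z = set0).
    by under eq_fun do rewrite Rintegral_set0; exact: cvg_cst.
  by apply/seteqP; split=> // y [_ /= ky]; apply: nj; eexists; exact: ky.
case: p pj => [[[g0 g1] g2] g] pj.
have Zq y : Z y -> q y = (g0, g1, g2, g).
  by move=> [_ /= ky]; apply: (can_inj codeK); rewrite ky.
have ZY : Z `<=` Y by exact: subIsetl.
have fZ : finite_measurable m Z by exact: finite_measurableI.
have mZ : measurable Z by case: fZ.
pose A := (fun y => b l (a g y)) @^-1` Z.
have E1 n : \int[m]_(y in Z) straightened_integrand (w n) l0 l1 l2 l y =
    average2 (w n) (induced_cochain A) g0 g1 g2 g.
  by apply: straightened_integral_piece => // y /Zq[-> -> ->].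
have E2 n : \int[m]_(y in Z) straightened_integrand (w n) 1 1 1 l y =
    average2 (w n) (induced_cochain A) 1 1 1 g.
  apply: straightened_integral_piece => // y /ZY[_ /= ky].
  by rewrite invg1 b1 ky.
under eq_fun do rewrite (Rintegral_boundedB fZ (hb _ _ _ _) (hb _ _ _ _)) E1 E2.
have mA : measurable A.
  have ma := (amp g).1; have mb := (bmp l).1.
  by have mT := measurableT_comp mb ma; have := mT measurableT _ mZ; rewrite setTI.
have AY : A `<=` Y.
  move=> y Zy; have [DT _] := ZY _ Zy; move: (Zq _ Zy).
  have Dgy : D (a g y) by rewrite -[a g y]b1 -(mulVg l) bM; exact: Db.
  have Dy : D y by rewrite -[y]a1 -(mulVg g) aM; exact: Da.
  move=> [_ _ _]; rewrite -bM mulVg b1 ke// => kg; split=> //=.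
  by rewrite -[LHS](mulKg g) kg mulVg.
have fA := finite_measurableS mA AY fY.
apply: wP.
- exact: induced_cochain_equivariant.
- by move=> x y z; exact: induced_cochain_l2.
- exact: induced_cochain_cocycle.
Qed.

End Transfer.

(** A filter finer than the image cannot contain a set whose preimage is
    missed by F, as F contains the complement of that preimage. *)
Lemma fmap_ultra (T U : Type) (F : set_system T) (f : T -> U) :
  UltraFilter F -> UltraFilter (f @ F).
Proof.
move=> FU; have FF : ProperFilter F := ultra_proper.
split; first exact: fmap_proper_filter.
move=> G GP fG; apply/seteqP; split => // A GA.
have [//|nA] := in_ultra_setVsetC (f @^-1` A) FU.
have GnA : G (~` A) by exact: fG.
by case: (@filter_not_empty _ G GP); rewrite -(setICr A); exact: filterI.
Qed.

Lemma bounded_ultralimit (R : realType) (I : Type) (u : I -> nat -> R) (K : I -> R) :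
  (forall i n, `|u i n| <= K i) ->
  exists (F : set_system nat), [/\ ProperFilter F, \oo `<=` F &
    exists v : I -> R, forall i, u i @ F --> v i].
Proof.
move=> uK; have [F [FU Foo]] := ultraFilterLemma (@eventually_filter : ProperFilter \oo).
exists F; split => //; first exact: ultra_proper.
suff h i : exists x : R, u i @ F --> x.
  by exists (fun i => projT1 (cid (h i))) => i; exact: projT2 (cid (h i)).
have := @segment_compact R (- K i) (K i); rewrite compact_ultra.
move=> /(_ (u i @ F) (fmap_ultra (u i) FU)).
have uF : (u i @ F) [set` `[- K i, K i]%R].
  by rewrite /fmap/=; apply: (@filterE _ F) => n /=; rewrite in_itv/= -ler_norml; exact: uK.
move=> /(_ uF)[x [_ ux]].
by exists x.
Qed.

(** The limit along one ultrafilter is linear and keeps equivariance and the l^2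
    bound.  In the limit, c - d L has the constant value W, and a cochain that is
    constant in the group variables is its own coboundary. *)
Theorem coupling_real_H2b_vanishes d (S : measurableType d) (R : realType)
    (m : {measure set S -> \bar R}) (G H : groupType) a b D kappa chi :
  countable [set: G] -> countable [set: H] -> @coupling d S R m G H a b D kappa chi ->
  real_H2b_vanishes R G -> real_H2b_vanishes R H.
Proof.
move=> cG cH cpl vG c C cinv cC cc.
have [w [wp wP]] := average2_cvg cG vG.
pose h n x z l := homotopy m a b D kappa chi c (w n) x z l.
have hC n x z : l2_le (4 * C) (h n x z) := homotopy_l2 cG cH cpl cC (wp n) x z.
have [F [FF Foo [v vP]]] := bounded_ultralimit
  (u := fun (i : H * H * H) n => h n i.1.1 i.1.2 i.2) (K := fun=> 4 * C + 1)
  (fun i n => l2_le_norm i.2 (hC n i.1.1 i.1.2)).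
pose L x z l := v (x, z, l).
have LP x z l : h n x z l @[n --> F] --> L x z l by exact: (vP (x, z, l)).
have Linv : equivariant1 L.
  move=> g x z l; apply: (norm_cvg_unique (LP _ _ _)).
  rewrite (_ : (fun n => h n (g * x)%g (g * z)%g (g * l)%g) = (fun n => h n x z l)).
    exact: LP.
  by apply/funext => n; rewrite /h (homotopy_equivariant cG cH cpl cinv cC).
have LC x z : l2_le (4 * C) (L x z).
  move=> r ur.
  have sumP : \sum_(l <- r) h n x z l ^+ 2 @[n --> F] --> \sum_(l <- r) L x z l ^+ 2.
    elim: r {ur} => [|l r IHr].
      by under eq_fun do rewrite big_nil; rewrite big_nil; exact: cvg_cst.
    under eq_fun do rewrite big_cons; rewrite big_cons.
    by apply: cvgD IHr; rewrite expr2; apply: cvgM; exact: LP.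
  apply: (ler_cvg_to sumP (cvg_cst (4 * C))).
  by apply: filterE => n; exact: hC.
pose W x y z l := c x y z l - coboundary1 L x y z l.
have Winv : equivariant2 W.
  by move=> g x y z l; rewrite /W /coboundary1 cinv !Linv.
have WP x y z l : straightened m a b D kappa chi c (w n) x y z l @[n --> F] --> W x y z l.
  under eq_fun do rewrite -(homotopy_coboundary cG cH cpl cC cc (wp _)).
  apply: cvgB; first exact: cvg_cst.
  by apply: cvgD; [apply: cvgB|]; exact: LP.
have Wconst x y z l : W x y z l = W 1%g 1%g 1%g l.
  apply/eqP; rewrite -subr_eq0; apply/eqP.
  apply: (norm_cvg_unique (cvgB (WP x y z l) (WP 1%g 1%g 1%g l))).
  have h0 := straightened_cvg cG cH cpl cinv cC cc wp wP x y z l.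
  exact: cvg_trans (cvg_app _ Foo) h0.
exists (fun x y l => L x y l + W 1%g 1%g 1%g l); eexists; split.
- move=> g x y l; rewrite Linv; congr (_ + _).
  by rewrite -(Wconst g g g) -{1 2 3}(mulg1 g) Winv.
- move=> x y; apply: l2_leD (LC x y) _; apply: l2_leB (cC _ _ _) _.
  by apply: l2_leD (LC _ _); exact: l2_leB (LC _ _) (LC _ _).
- move=> x y z l; have := Wconst x y z l; rewrite {1}/W /coboundary1; lra.
Qed.

(** * Complex cochains with values in the regular representation *)

Section RegularRepresentationCochains.
Variables (R : realType) (G : groupType).
Import ComplexField.Normc.
Local Notation C := R[i].
Local Notation V := (l2 R G).

Lemma l2_norm_l2_le (f : V) (M : C) : `|f| <= M ->
  l2_le (complex.Re M ^+ 2) (fun x => complex.Re (f x)) /\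
  l2_le (complex.Re M ^+ 2) (fun x => complex.Im (f x)).
Proof.
move=> fM; have fM' : l2_norm f <= complex.Re M.
  by move: fM; rewrite /Num.norm/= lecE /= => /andP[].
have f0 : 0 <= l2_norm f by exact: sqrtr_ge0.
suff key (phi : G -> R) : (forall x, phi x ^+ 2 <= normc (f x) ^+ 2) ->
    l2_le (complex.Re M ^+ 2) phi.
  split; apply: key => x; case: (l2_fun f x) => p q /=; rewrite sqr_sqrtr ?addr_ge0 ?sqr_ge0//.
    by rewrite lerDl sqr_ge0.
  by rewrite lerDr sqr_ge0.
move=> phif r ur; apply: (@le_trans _ _ (l2_norm f ^+ 2)); last by rewrite lerXn2r// nnegrE (le_trans f0).
rewrite /l2_norm sqr_sqrtr ?fine_ge0 ?l2_sqnorm_ge0// -lee_fin l2_sqnormK ?l2_funP//.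
apply: (@le_trans _ _ (\sum_(x <- r) (normc (f x) ^+ 2)%:E)%E).
  by rewrite sumEFin lee_fin; apply: ler_sum.
apply: esum_ge; exists [set` r]; first by split => //; exact: finite_seq.
by rewrite -fsbig_seq.
Qed.

Lemma l2_le_square_summable (phi psi : G -> R) A B : l2_le A phi -> l2_le B psi ->
  (l2_sqnorm (fun x => (phi x +i* psi x)%C : C^o) <= (A + B)%:E)%E.
Proof.
move=> hA hB; apply: ge_ereal_sup => _ [F [finF _] <-].
rewrite fsbig_finite//= sumEFin lee_fin.
under eq_bigr do rewrite sqr_sqrtr ?addr_ge0 ?sqr_ge0//.
by rewrite big_split/= lerD// ?hA ?hB// finmap.fset_uniq.
Qed.

Lemma l2_exists (phi psi : G -> R) A B : l2_le A phi -> l2_le B psi ->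
  exists f : V, (forall x, f x = (phi x +i* psi x)%C) /\
    `|f| <= (Num.sqrt (A + B))%:C%C.
Proof.
move=> hA hB; have le := l2_le_square_summable hA hB.
have sq : (fun x => (phi x +i* psi x)%C : C^o) \in @square_summable R G.
  by rewrite unfold_in; exact: le_lt_trans le (ltry _).
exists (L2 sq); split => //.
rewrite /Num.norm/= lecR ler_wsqrtr// -lee_fin l2_sqnormK//.
Qed.

Definition tuple2 (x y : G) : 'I_2 -> G := fun i => nth x [:: x; y] i.
Definition tuple3 (x y z : G) : 'I_3 -> G := fun i => nth x [:: x; y; z] i.
Definition tuple4 (x y z t : G) : 'I_4 -> G := fun i => nth x [:: x; y; z; t] i.

Lemma tuple3E (u : 'I_3 -> G) : exists x y z, u = tuple3 x y z.
Proof.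
exists (u ord0), (u (lift ord0 ord0)), (u (lift ord0 (lift ord0 ord0))).
apply/funext => -[[|[|[|i]]] hi] //=; rewrite /tuple3 /=; congr u; exact: val_inj.
Qed.

Lemma tuple2E (u : 'I_2 -> G) : exists x y, u = tuple2 x y.
Proof.
exists (u ord0), (u (lift ord0 ord0)).
apply/funext => -[[|[|i]] hi] //=; rewrite /tuple2 /=; congr u; exact: val_inj.
Qed.

Lemma tuple4E (u : 'I_4 -> G) : exists x y z t, u = tuple4 x y z t.
Proof.
exists (u ord0), (u (lift ord0 ord0)), (u (lift ord0 (lift ord0 ord0))),
  (u (lift ord0 (lift ord0 (lift ord0 ord0)))).
apply/funext => -[[|[|[|[|i]]]] hi] //=; rewrite /tuple4 /=; congr u; exact: val_inj.
Qed.

Lemma coboundary_tuple3 (f : cochain G V 1) x y z :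
  coboundary f (tuple3 x y z) = f (tuple2 y z) - f (tuple2 x z) + f (tuple2 x y).
Proof.
rewrite /coboundary !big_ord_recl big_ord0 /= addr0 !expr0 !expr1 scale1r scaleN1r.
rewrite -signr_odd /= expr0 scale1r addrA.
by congr (f _ - f _ + f _); apply/funext => -[[|[|i]] hi].
Qed.

Lemma coboundary_tuple4 (f : cochain G V 2) x y z t :
  coboundary f (tuple4 x y z t) =
  f (tuple3 y z t) - f (tuple3 x z t) + f (tuple3 x y t) - f (tuple3 x y z).
Proof.
rewrite /coboundary !big_ord_recl big_ord0 /= addr0 !expr0 !expr1 scale1r scaleN1r.
rewrite -signr_odd /= expr0 scale1r -[in X in _ + (_ + (_ + X))]signr_odd /= expr1 scaleN1r !addrA.
by congr (f _ - f _ + f _ - f _); apply/funext => -[[|[|[|i]]] hi].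
Qed.

Lemma cochain_act_tuple3 (f : cochain G V 2) g x y z t :
  cochain_act (regular_rep R G) g f (tuple3 (g * x) (g * y) (g * z))%g (g * t)%g =
  f (tuple3 x y z) t.
Proof.
rewrite /cochain_act /= mulKg; congr (l2_fun (f _) _).
by apply/funext => -[[|[|[|i]]] hi]//; rewrite /tuple3 /= mulKg.
Qed.

Lemma cochain_act_tuple2 (f : cochain G V 1) g x y t :
  cochain_act (regular_rep R G) g f (tuple2 (g * x) (g * y))%g (g * t)%g =
  f (tuple2 x y) t.
Proof.
rewrite /cochain_act /= mulKg; congr (l2_fun (f _) _).
by apply/funext => -[[|[|i]] hi]//; rewrite /tuple2 /= mulKg.
Qed.

Lemma l2_ext (f g : V) : (forall x, f x = g x) -> f = g.
Proof. by move=> fg; apply: val_inj; apply/funext. Qed.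

Lemma cochain2_invariant (f : cochain G V 2) :
  (forall g x y z t, f (tuple3 (g * x) (g * y) (g * z))%g (g * t)%g = f (tuple3 x y z) t) ->
  forall g, cochain_act (regular_rep R G) g f = f.
Proof.
move=> h g; apply/funext => u; have [x [y [z ->]]] := tuple3E u.
apply: l2_ext => t.
rewrite -[x](mulVKg g) -[y](mulVKg g) -[z](mulVKg g) -[t](mulVKg g).
by rewrite cochain_act_tuple3 -(h g).
Qed.

Lemma cochain1_invariant (f : cochain G V 1) :
  (forall g x y t, f (tuple2 (g * x) (g * y))%g (g * t)%g = f (tuple2 x y) t) ->
  forall g, cochain_act (regular_rep R G) g f = f.
Proof.
move=> h g; apply/funext => u; have [x [y ->]] := tuple2E u.
apply: l2_ext => t.
rewrite -[x](mulVKg g) -[y](mulVKg g) -[t](mulVKg g).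
by rewrite cochain_act_tuple2 -(h g).
Qed.

Lemma bounded_coboundary_cocycle (h : cochain G V 1) :
  bounded_invariant_cochains (regular_rep R G) h ->
  bounded_cocycles (regular_rep R G) (coboundary h).
Proof.
move=> [[M hM] hinv]; split; first split.
- exists (M + M + M) => u; have [x [y [z ->]]] := tuple3E u.
  rewrite coboundary_tuple3; apply: le_trans (ler_normD _ _) _; apply: lerD => //.
  by apply: le_trans (ler_normB _ _) _; apply: lerD.
- apply: cochain2_invariant => g x y z t; rewrite !coboundary_tuple3.
  rewrite -[LHS]/(h (tuple2 (g * y) (g * z))%g (g * t)%g -
    h (tuple2 (g * x) (g * z))%g (g * t)%g + h (tuple2 (g * x) (g * y))%g (g * t)%g).
  by rewrite -[h in LHS](hinv g) !cochain_act_tuple2.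
- apply/funext => u; have [x [y [z [t ->]]]] := tuple4E u.
  rewrite coboundary_tuple4 !coboundary_tuple3; apply: l2_ext => s.
  set A := h (tuple2 z t); set B := h (tuple2 y t); set E := h (tuple2 y z).
  set F := h (tuple2 x t); set I := h (tuple2 x z); set J := h (tuple2 x y).
  rewrite -[LHS]/((A s - B s + E s) - (A s - F s + I s) + (B s - F s + J s) -
     (E s - I s + J s)) -[RHS]/(0 : C).
  ring.
Qed.

(** A complex cocycle is solved by solving its real and imaginary parts; a real
    cocycle is solved by the real part of a complex solution. *)
Lemma bounded_cohomology_vanishesP :
  bounded_cohomology_vanishes (regular_rep R G) 2 <-> real_H2b_vanishes R G.
Proof.
split=> [van c A cinv cA cc|van].
  have z0 : l2_le 0 (fun _ : G => 0 : R) by move=> r _; rewrite big1// => x _; rewrite expr0n.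
  pose f (u : 'I_3 -> G) : V := projT1 (cid (l2_exists
    (cA (u ord0) (u (lift ord0 ord0)) (u (lift ord0 (lift ord0 ord0)))) z0)).
  have fE x y z t : f (tuple3 x y z) t = (c x y z t)%:C%C.
    by rewrite /f; case: cid => /= e [-> _].
  have fM u : `|f u| <= (Num.sqrt (A + 0))%:C%C.
    by rewrite /f; case: cid => /= e [_].
  have : bounded_cocycles (regular_rep R G) f.
    split; first split.
    - by exists (Num.sqrt (A + 0))%:C%C.
    - by apply: cochain2_invariant => g x y z t; rewrite !fE cinv.
    - apply/funext => u; have [x [y [z [t ->]]]] := tuple4E u.
      rewrite coboundary_tuple4; apply: l2_ext => s.
      rewrite -[LHS]/(f (tuple3 y z t) s - f (tuple3 x z t) s + f (tuple3 x y t) s -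
        f (tuple3 x y z) s) -[RHS]/(0 : C) !fE.
      by rewrite -rmorphB -rmorphD -rmorphB cc.
  rewrite van => -[h [[M hM] hinv] hf].
  exists (fun x y t => complex.Re (h (tuple2 x y) t)), (complex.Re M ^+ 2); split.
  - move=> g x y t; rewrite -[h in LHS](hinv g) cochain_act_tuple2//.
  - by move=> x y; case: (l2_norm_l2_le (hM (tuple2 x y))).
  - move=> x y z t; have := fE x y z t; rewrite -hf coboundary_tuple3.
    rewrite -[X in X = _]/(h (tuple2 y z) t - h (tuple2 x z) t + h (tuple2 x y) t).
    move=> /(congr1 (@complex.Re R)) /= <-; rewrite /coboundary1.
    by case: (l2_fun _ t) => ? ?; case: (l2_fun _ t) => ? ?; case: (l2_fun _ t).
apply/seteqP; split=> [f|_ [h hb <-]]; last exact: bounded_coboundary_cocycle.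
move=> [[[M fM] finv] df].
have inv (p : C -> R) : equivariant2 (fun x y z t => p (f (tuple3 x y z) t)).
  by move=> g x y z t; rewrite -[f in LHS](finv g) cochain_act_tuple3.
have coc (p : {additive C -> R}) : cocycle2 (fun x y z t => p (f (tuple3 x y z) t)).
  move=> x y z t s; rewrite -raddfB -raddfD -raddfB.
  have := congr1 (fun k => k (tuple4 x y z t)) df.
  rewrite coboundary_tuple4 => /(congr1 (fun e : V => e s)).
  rewrite -[X in X = _]/(f (tuple3 y z t) s - f (tuple3 x z t) s + f (tuple3 x y t) s -
        f (tuple3 x y z) s) => ->.
  exact: raddf0.
have fre x y z := (l2_norm_l2_le (fM (tuple3 x y z))).1.
have fim x y z := (l2_norm_l2_le (fM (tuple3 x y z))).2.
have [k1 [D1 [k1inv k1D k1E]]] := van _ _ (inv (@complex.Re R)) fre (coc _).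
have [k2 [D2 [k2inv k2D k2E]]] := van _ _ (inv (@complex.Im R)) fim (coc _).
pose h (u : 'I_2 -> G) : V := projT1 (cid (l2_exists
  (k1D (u ord0) (u (lift ord0 ord0))) (k2D (u ord0) (u (lift ord0 ord0))))).
have hE x y t : h (tuple2 x y) t = (k1 x y t +i* k2 x y t)%C.
  by rewrite /h; case: cid => /= e [-> _].
have hM u : `|h u| <= (Num.sqrt (D1 + D2))%:C%C.
  by rewrite /h; case: cid => /= e [_].
exists h; first split.
- by exists (Num.sqrt (D1 + D2))%:C%C.
- by apply: cochain1_invariant => g x y t; rewrite !hE k1inv k2inv.
- apply/funext => u; have [x [y [z ->]]] := tuple3E u.
  rewrite coboundary_tuple3; apply: l2_ext => t.
  rewrite -[LHS]/(h (tuple2 y z) t - h (tuple2 x z) t + h (tuple2 x y) t) !hE.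
  have := k1E x y z t; have := k2E x y z t; rewrite /coboundary1.
  case: (l2_fun _ t) => p q /= -> ->; apply/eqP.
  by rewrite eq_complex /= !eqxx.
Qed.

End RegularRepresentationCochains.

(** A coupling is symmetric in the two groups, so one implication is enough. *)
Theorem theorem1p18 (R : realType) (G H : groupType)
    (countG : countable [set: G]%classic) (countH : countable [set: H]%classic)
    (GH : measure_equivalent R G H) :
  bounded_cohomology_vanishes (regular_rep R G) 2 <->
  bounded_cohomology_vanishes (regular_rep R H) 2.
Proof.
have [d [S [m [a [b [D [kappa [chi cpl]]]]]]]] := measure_equivalent_coupling countG countH GH.
rewrite !bounded_cohomology_vanishesP; split.
  exact: coupling_real_H2b_vanishes countG countH cpl.
exact: coupling_real_H2b_vanishes countH countG (coupling_sym cpl).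
Qed.
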